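(* Let $(\{S_k\}_{k=1}^n,\{S_k\}_{k=n+1}^{n+m})$ be a centred self-adjoint bi-free central limit distribution with respect to $\varphi$ in a C$^*$-non-commutative probability space $(\mathcal A,\varphi)$ (with $S_1,\ldots,S_n$ the left variables and $S_{n+1},\ldots,S_{n+m}$ the right variables) such that $\varphi(S_k^2)=1$ for all $k$. Its joint distribution is completely determined by the positive matrix $A=[\varphi(S_iS_j)]_{i,j=1}^{n+m}\in\mathcal M_{n+m}(\mathbb R)$. Then \[ \chi(S_1,\ldots,S_n\sqcup S_{n+1},\ldots,S_{n+m})=\frac{n+m}2\log(2\pi e)+\frac12\log(\det(A)), \] with the convention $\log 0=-\infty$.
   Context: A C$^*$-non-commutative probability space $(\mathcal A,\varphi)$ is a unital C$^*$-algebra with a state $\varphi$. Centred self-adjoint bi-free central limit distribution: self-adjoint operators $S_1,\ldots,S_n$ (left) and $S_{n+1},\ldots,S_{n+m}$ (right) for which there are a real Hilbert space $\mathcal H$ and vectors $e_1,\ldots,e_{n+m}\in\mathcal H$ with $\langle e_i,e_j\rangle=\varphi(S_iS_j)$ such that the joint moments of the $S_k$ with respect to $\varphi$ equal the joint moments, with respect to the vacuum vector state, of the operators $l(e_k)+l^*(e_k)$ for $1\le k\le n$ and $r(e_k)+r^*(e_k)$ for $n+1\le k\le n+m$ acting on the full Fock space $\mathcal F(\mathcal H)$, where $l(e),r(e)$ are the left and right creation operators and $l^*(e),r^*(e)$ the corresponding annihilation operators. Such a system is tracially bi-partite: left variables commute with right variables in distribution and $\varphi$ is tracial on the algebra generated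 by the left variables and on the algebra generated by the right variables. Microstate bi-free entropy of a tracially bi-partite system of self-adjoint operators $X_1,\ldots,X_n$ (left), $Y_1,\ldots,Y_m$ (right). $\mathcal M_d$ is the algebra of complex $d\times d$ matrices, $\mathcal M_d^{sa}$ its self-adjoint part, $\mathrm{Tr}_d$ the trace, $\tau_d=\frac1d\mathrm{Tr}_d$, $\|\cdot\|$ the operator norm, and $\lambda_{d,p}$ is Lebesgue measure on $(\mathcal M_d^{sa})^p$ normalized by the inner product $\langle (A_i),(B_i)\rangle=\sum_i\mathrm{Tr}_d(A_iB_i)$. For $M,d\in\mathbb N$ and $R,\epsilon>0$, $\Gamma_R(X_1,\ldots,X_n\sqcup Y_1,\ldots,Y_m;M,d,\epsilon)$ is the set of $(A_1,\ldots,A_n,B_1,\ldots,B_m)\in(\mathcal M_d^{sa})^{n+m}$ with $\|A_i\|,\|B_j\|\le R$ for all $i,j$ and \[ |\varphi(X_{i_1}\cdots X_{i_p}Y_{j_1}\cdots Y_{j_q})-\tau_d(A_{i_1}\cdots A_{i_p}B_{j_q}\cdots B_{j_1})|<\epsilon \] for all $p,q\ge0$ with $1\le p+q\le M$ and all indices. Define (with $\log 0=-\infty$) $\chi_R(\cdot;M,d,\epsilon)=\log\lambda_{d,n+m}(\Gamma_R(\cdot;M,d,\epsilon))$, $\chi_R(\cdot;M,\epsilon)=\limsup_{d\to\infty}\big(\frac1{d^2}\chi_R(\cdot;M,d,\epsilon)+\frac{n+m}2\log d\big)$, $\chi_R(\cdot)=\inf_{M\in\mathbb N,\epsilon>0}\chi_R(\cdot;M,\epsilon)$,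 and $\chi(X_1,\ldots,X_n\sqcup Y_1,\ldots,Y_m)=\sup_{R>0}\chi_R(X_1,\ldots,X_n\sqcup Y_1,\ldots,Y_m)\in[-\infty,\infty)$. *)

(* Defs.v *)
From HB Require Import structures.
From mathcomp Require Import all_boot all_order all_algebra.
From mathcomp Require Import complex.
From mathcomp Require Import all_classical all_reals all_analysis.
Import Order.TTheory GRing.Theory Num.Theory.
Import numFieldNormedType.Exports.

Set Implicit Arguments.
Unset Strict Implicit.
Unset Printing Implicit Defensive.

Local Open Scope classical_set_scope.
Local Open Scope complex_scope.
Local Open Scope ring_scope.

(* Unital C*-algebras.  The library has no join of [algType] with normed modules,
   so the norm is a field of the record. *)
Record cstarAlgType (R : realType) := CstarAlgType {
  cstar_sort :> algType R[i] ;
  star : cstar_sort -> cstar_sort ;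
  cstarn : cstar_sort -> R ;
  starK : involutive star ;
  starD : forall x y, star (x + y) = star x + star y ;
  starZ : forall (a : R[i]) x, star (a *: x) = conjc a *: star x ;
  starM : forall x y, star (x * y) = star y * star x ;
  cstarn0_eq0 : forall x, cstarn x = 0 -> x = 0 ;
  cstarnD_le : forall x y, cstarn (x + y) <= cstarn x + cstarn y ;
  cstarnZ : forall (a : R[i]) x,
    cstarn (a *: x) = complex.Re `|a| * cstarn x ;
  cstarnM_le : forall x y, cstarn (x * y) <= cstarn x * cstarn y ;
  cstarn_star : forall x, cstarn (star x * x) = cstarn x ^+ 2 ;
  cstar_complete : forall u : nat -> cstar_sort,
    cstarn (u k.1 - u k.2) @[k --> (\oo, \oo)] --> (0 : R) ->
    exists l, cstarn (u k - l) @[k --> \oo] --> (0 : R) }.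

(* On [R[i]], [0 <= z] says that [z] is real and nonnegative. *)
Definition is_state (R : realType) (A : cstarAlgType R) (phi : {scalar A}) :=
  (forall a : A, 0 <= phi (star a * a)) /\ phi 1 = 1.

Definition self_adjoint (R : realType) (A : cstarAlgType R) (a : A) :=
  star a = a.

(* A Hilbert space over [K]; [theta] is [idfun] for real scalars and complex
   conjugation for complex ones.  The form is linear in its first argument. *)
Record hilbertSpace (K : numFieldType) (theta : K -> K) := HilbertSpace {
  hilbert_sort :> completeNormedModType K ;
  hdot : {dot hilbert_sort for theta} ;
  hdot_norm : forall x : hilbert_sort, hdot x x = `|x| ^+ 2 }.

Notation realHilbert R := (@hilbertSpace R idfun).
Notation complexHilbert R := (@hilbertSpace R[i] Num.conj).

(* The full Fock space of (the complexification of) a real Hilbert space: the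
   Hilbert space, unique up to a unitary, densely spanned by the simple tensors
   [tensor [:: x1; ..; xk]] = x1 (x) .. (x) xk; [tensor [::]] is the vacuum.
   Multilinearity of [tensor] follows from [tensor_dot]. *)
Record fockSpace (R : realType) (H : realHilbert R) := FockSpace {
  fock_hilbert :> complexHilbert R ;
  tensor : seq H -> fock_hilbert ;
  tensor_dot : forall xs ys : seq H,
    hdot fock_hilbert (tensor xs) (tensor ys) =
    if size xs == size ys
    then (\prod_(p <- zip xs ys) hdot H p.1 p.2)%:C else 0 ;
  tensor_dense : dense [set v : fock_hilbert |
    exists s : seq (R[i] * seq H), v = \sum_(p <- s) p.1 *: tensor p.2] }.

Section fock.
Variables (R : realType) (H : realHilbert R) (F : fockSpace H).

Definition vacuum : F := tensor F [::].

Definition is_left_creation (e : H) (l : F -> F) :=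
  [/\ linear l, continuous l &
      forall xs, l (tensor F xs) = tensor F (e :: xs)].

Definition is_right_creation (e : H) (r : F -> F) :=
  [/\ linear r, continuous r &
      forall xs, r (tensor F xs) = tensor F (rcons xs e)].

Definition is_adjoint (T T' : F -> F) :=
  forall x y : F, hdot F (T x) y = hdot F x (T' y).

End fock.

(* [S (lshift m i)] are the left variables, [S (rshift n j)] the right ones;
   [c k] is the creation operator l(e_k), resp. r(e_k), and [a k] the
   corresponding annihilation operator. *)
Definition bifree_central_limit (R : realType) (A : cstarAlgType R)
    (phi : {scalar A}) (n m : nat) (S : 'I_(n + m) -> A) :=
  (forall k, self_adjoint (S k)) /\
  exists (H : realHilbert R) (e : 'I_(n + m) -> H) (F : fockSpace H)
         (c a : 'I_(n + m) -> F -> F),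
  [/\ forall i j, (hdot H (e i) (e j))%:C = phi (S i * S j),
      forall i : 'I_n, is_left_creation (e (lshift m i)) (c (lshift m i)),
      forall j : 'I_m, is_right_creation (e (rshift n j)) (c (rshift n j)),
      forall k, is_adjoint (c k) (a k) &
      forall w : seq 'I_(n + m), phi (\prod_(k <- w) S k) =
        hdot F (foldr (fun k v => c k v + a k v) (vacuum F) w) (vacuum F)].

(* The real matrix [phi (S_i S_j)]; that these values are real is part of the
   theorem. *)
Definition cov_mx (R : realType) (A : cstarAlgType R) (phi : {scalar A})
    (p : nat) (S : 'I_p -> A) : 'M[R]_p :=
  \matrix_(i, j) complex.Re (phi (S i * S j)).

Definition positive_mx (R : realType) (p : nat) (M : 'M[R]_p) :=
  M^T = M /\ forall v : 'rV[R]_p, 0 <= (v *m M *m v^T) 0 0.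

Section matrices.
Variable R : realType.

Definition vnorm (d : nat) (v : 'cV[R[i]]_d) : R :=
  Num.sqrt (\sum_i (complex.Re (v i 0) ^+ 2 + complex.Im (v i 0) ^+ 2)).

Definition opnorm (d : nat) (A : 'M[R[i]]_d) : R :=
  sup [set vnorm (A *m v) | v in [set v | vnorm v <= 1]].

Definition ntrace (d : nat) (A : 'M[R[i]]_d) : R[i] := (d%:R)^-1 * \tr A.

(* Coordinates of the self-adjoint d x d matrices in the basis E_ii,
   (E_ij + E_ji)/sqrt 2 and i(E_ij - E_ji)/sqrt 2 (i < j), which is orthonormal
   for Tr(AB). *)
Definition sa_mx (d : nat) (x : 'I_d -> 'I_d -> R) : 'M[R[i]]_d :=
  \matrix_(i, j)
    if i == j then (x i i)%:C
    else if (i < j)%N then (x i j / Num.sqrt 2) +i* (x j i / Num.sqrt 2)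
    else (x j i / Num.sqrt 2) -i* (x i j / Num.sqrt 2).

Definition sa_family (p d : nat) (t : (p * (d * d)).-tuple R) (k : 'I_p) :
    'M[R[i]]_d :=
  sa_mx (fun i j => tnth t (mxvec_index k (mxvec_index i j))).

(* Lebesgue measure on R^N, as an iterated product. *)
Fixpoint lebesgue_tuple (N : nat) : set (N.-tuple R) -> \bar R :=
  match N with
  | 0 => fun B => (\d_([tuple] : 0.-tuple R) B)%E
  | N'.+1 => fun B => (lebesgue_measure \x @lebesgue_tuple N')%E
      [set xt : R * N'.-tuple R | B (cons_tuple xt.1 xt.2)]
  end.

(* Lebesgue measure lambda_{d,p} of a set of p-tuples of d x d matrices,
   transported from R^(p d^2) through the orthonormal coordinates above. *)
Definition lambda (d p : nat) (G : set ('I_p -> 'M[R[i]]_d)) : \bar R :=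
  lebesgue_tuple [set t | G (@sa_family p d t)].

End matrices.

Section entropy.
Variables (R : realType) (A : cstarAlgType R) (phi : {scalar A}).
Variables (n m : nat) (X : 'I_n -> A) (Y : 'I_m -> A).

Definition microstates (r : R) (M d : nat) (eps : R) :
    set ('I_(n + m) -> 'M[R[i]]_d) :=
  [set B | [/\ forall k, B k \is hermsymmx, forall k, opnorm (B k) <= r &
    forall (u : seq 'I_n) (v : seq 'I_m), (1 <= size u + size v <= M)%N ->
      `|phi ((\prod_(i <- u) X i) * (\prod_(j <- v) Y j)) -
        ntrace ((\prod_(i <- u) B (lshift m i)) *
                (\prod_(j <- rev v) B (rshift n j)))| < eps%:C]].

Definition chi_RMe (r : R) (M : nat) (eps : R) : \bar R :=
  limn_esup (fun d : nat =>
    (((d%:R ^+ 2)^-1)%:E * lne (lambda (@microstates r M d eps)) +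
     ((n + m)%:R / 2 * ln d%:R)%:E)%E).

Definition chi_R (r : R) : \bar R :=
  ereal_inf [set y | exists (M : nat) (eps : R), 0 < eps /\ y = chi_RMe r M eps].

Definition chi : \bar R :=
  ereal_sup [set y | exists r : R, 0 < r /\ y = chi_R r].

End entropy.

(* Main.v *)
(* Write p = n + m and let A be the covariance matrix.  The joint moments of the
   S_k are sums over non-crossing pairings, s(k w) = sum over w = u l v of
   A_kl s(u) s(v); since creation and annihilation on the left commute with those
   on the right up to the vacuum, a mixed moment of a left word u and a right word
   v equals s(u rev(v)), which is the limit of normalized traces of words in
   Gaussian matrices of covariance A.

   Upper bound: let A + delta I = L L^T with L lower triangular, and substitute
   X = d^(-1/2) L G(t) in Lebesgue measure.  On a microstate the second moments
   give |t|^2 <= d^2 (p + C eps), so the indicator function of the microstates is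
   at most exp(d^2 (p + C eps) / 2) exp(-|t|^2 / 2), whose integral is explicit.
   Then let eps and delta tend to 0.

   Lower bound, when A = L L^T is invertible: microstates now satisfy
   |t|^2 >= d^2 (p - C eps), and their Gaussian probability tends to 1.  The latter
   is a Markov inequality for the polynomial
   q = eps^(-2) sum_w |tau(w) - s(w)|^2 + sum_k Tr X_k^(2K) / R^(2K),
   whose mean is computed by the Schwinger-Dyson equations (Gaussian integration by
   parts); they also bound the mean of tau(X_k^(2K)) by 8^(2K) when
   (2K + 1)^3 <= d^2, which controls the operator norms. *)
Require Import Defs.
From HB Require Import structures.
From mathcomp Require Import all_boot all_order all_algebra.
From mathcomp Require Import complex.
From mathcomp Require Import all_classical all_reals all_analysis.
From mathcomp Require Import measurable_realfun zify ring lra.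
From mathcomp Require Import -(notations) mpoly.
Import Order.TTheory GRing.Theory Num.Theory.
Import numFieldNormedType.Exports.

Local Open Scope classical_set_scope.
Local Open Scope complex_scope.
Local Open Scope ring_scope.

Set Implicit Arguments.
Unset Strict Implicit.
Unset Printing Implicit Defensive.

(** * Gaussian integration in R^N *)

(** The measure of a set is an iterated integral over the coordinates. Hence both bounds are
    pointwise comparisons of the indicator function of the microstates with a polynomial times the
    Gaussian weight, a form that survives integrating out one variable; and the matrices are mixed
    by a triangular factor rather than by the square root of the covariance. The value of the
    entropy is visible in this substitution: its Jacobian has logarithm d^2 ln(prod L_kk) - (p d^2 /
    2) ln d, where (prod L_kk)^2 is the determinant and the second term cancels the normalization (p
    / 2) log d. The obstacle in the lower bound is the cut-off R. Moments of fixed order converge,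
    but Tr = d tau costs a factor d, so operator norms are only controlled by powers whose order
    grows with d. This requires a moment bound valid for orders growing with d; the condition A_kk =
    1 enters there. *)

Section GaussianMoments.
Variable R : realType.
Notation mu := (@lebesgue_measure R).

(** The fundamental theorem of calculus on [-n, n] gives F(n) - F(-n); dominated convergence, with
    |f| as the bound, lets n tend to infinity. *)
Lemma integral_derivative_line (F f : R -> R) :
  continuous f -> (forall x, is_derive x (1:R) F (f x)) ->
  mu.-integrable [set: R] (EFin \o f) ->
  F n%:R @[n --> \oo] --> (0 : R) -> F (- n%:R) @[n --> \oo] --> (0 : R) ->
  (\int[mu]_x (f x)%:E = 0)%E.
Proof.
move=> cf dF intf F1 F2.
pose D (n : nat) : set R := `[- n%:R, n%:R]%classic.
have intn (n : nat) : (0 < n)%N ->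
    (\int[mu]_x (((EFin \o f) \_ (D n)) x) = (F n%:R - F (- n%:R))%:E)%E.
  move=> n0; rewrite -integral_mkcond.
  have cF : continuous F.
    by move=> x; apply/differentiable_continuous/derivable1_diffP; case: (dF x).
  apply: continuous_FTC2.
  - by rewrite ltrNl; apply: (@lt_trans _ _ 0); rewrite ?ltr0n ?oppr_lt0 ?ltr0n.
  - by apply: continuous_subspaceT => x; exact: cf.
  - split.
    + by move=> x _; case: (dF x).
    + by apply: cvg_at_right_filter; exact: cF.
    + by apply: cvg_at_left_filter; exact: cF.
  - by move=> x _; rewrite derive1E; exact: derive_val.
have /integrableP[mf _] := intf.
pose fe : R -> \bar R := EFin \o f.
pose fn n : R -> \bar R := fe \_ (D n).
have H1 n : measurable_fun [set: R] (fn n).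
  by apply/(measurable_restrictT _ _).1;
    [exact: measurable_itv|exact: measurable_funTS].
have H2 : {ae mu, forall x, setT x ->
    fn n x @[n --> \oo] --> fe x}.
  apply: aeW => x _; apply: (cvg_near_cst).
  exists (Num.truncn `|x|).+1 => // k /= kx.
  rewrite /fn patchE mem_set// /D/= in_itv/= -ler_norml ltW//.
  by rewrite (lt_le_trans (truncnS_gt _))// ler_nat.
have H3 : {ae mu, forall x n, setT x ->
    (`|fn n x| <= (abse \o fe) x)%E}.
  apply: aeW => x n _; rewrite /fn patchE; case: ifP => // _.
  by rewrite abse0 abse_ge0.
have [_ _ cvgI] := @dominated_convergence _ _ _ mu _ measurableT fn fe
  (abse \o fe) H1 mf H2 (integrable_abse intf) H3.
have c2 : (\int[mu]_x (((EFin \o f) \_ (D n)) x))%E @[n --> \oo] --> (0 : R)%:E.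
  have c3 : (F n%:R - F (- n%:R)) @[n --> \oo] --> (0 : R).
    by rewrite -[X in _ --> X](subr0 0); exact: cvgB.
  have : (F n%:R - F (- n%:R))%:E @[n --> \oo] --> (0 : R)%:E.
    by apply: cvg_EFin => //; exact: nearW.
  apply: cvg_trans; apply: near_eq_cvg.
  by exists 1%N => // n /= n1; rewrite intn.
by apply: cvg_unique cvgI c2.
Qed.

(** The moments of the standard normal law: 0 for odd [k] and the double factorial (k - 1)!! for
    even [k]. *)
Fixpoint gauss_moment (k : nat) : R :=
  match k with
  | 0 => 1
  | 1 => 0
  | (k'.+1 as j).+1 => j%:R * gauss_moment k'
  end.

Lemma gauss_momentSS k : gauss_moment k.+2 = k.+1%:R * gauss_moment k.
Proof. by []. Qed.

Variables (a b : R).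
Hypothesis a0 : 0 < a.

(** The integrals are computed in the image variable [y = a x + b] of a standard normal [x = z y];
    the factor [a] in the result plays the part of the Jacobian. *)
Let z (y : R) := (y - b) / a.
Let w (y : R) := expR (- (z y) ^+ 2 / 2).

Let z_derive y : is_derive y (1:R) z a^-1.
Proof.
have H : is_derive y (1:R) (fun y : R => (y - b) * a^-1) (1 * a^-1 + (y-b) * 0).
  have -> : 1 * a^-1 + (y-b) * 0 = (y - b) *: 0 + a^-1 *: (1 - 0) :> R.
    by rewrite /GRing.scale/=; ring.
  apply: is_deriveM.
by move: H; rewrite mulr0 addr0 mul1r.
Qed.

Let w_derive y : is_derive y (1:R) w (- z y / a * w y).
Proof.
have dz := z_derive y.
pose g (y : R) : R := - (z y) ^+ 2 / 2.
have H : is_derive y (1:R) g (- z y / a).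
  rewrite (_ : g = (- 2^-1) *: (z * z)); last first.
    by apply/funext => t; rewrite -[RHS]/(- 2^-1 * (z t * z t)) /g; field.
  apply: is_derive_eq.
  by rewrite /GRing.scale/=; field; rewrite gt_eqF.
have := is_derive1_comp (is_derive_expR (g y)) H.
by move=> D; apply: (is_derive_eq D); rewrite mulrC.
Qed.

Let F (n : nat) (y : R) := z y ^+ n * w y.

Let F0_derive y : is_derive y (1:R) (F 0) (- a^-1 * F 1 y).
Proof.
have -> : F 0 = w by apply/funext => t; rewrite /F expr0 mul1r.
have dw := w_derive y.
by apply: (@is_derive_eq _ _ _ _ _ _ _ _ dw); rewrite /F; field; rewrite gt_eqF.
Qed.

Let FS_derive n y : is_derive y (1:R) (F n.+1)
  (a^-1 * (n.+1%:R * F n y - F n.+2 y)).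
Proof.
have dw := w_derive y; have dz := z_derive y.
have -> : F n.+1 = (z ^+ n.+1) * w.
  by apply/funext => t; rewrite /F exprfctE.
have := is_deriveM (is_deriveX n.+1 dz) dw.
move=> D; apply: (is_derive_eq D); rewrite /GRing.scale/= /F exprfctE !exprS.
by field; rewrite gt_eqF.
Qed.

Let F_continuous n : continuous (F n).
Proof.
move=> y; apply/differentiable_continuous/derivable1_diffP.
by case: n => [|n]; [case: (F0_derive y)|case: (FS_derive n y)].
Qed.

Let v y := expR (- (z y) ^+ 2 / 4).

(** The decay exp(-t^2 / 2) is split in halves. One half absorbs the power, through u^n <= 1 +
    u^(2(n+1)) and one term of the exponential series, whence the constant; the other half is the
    integrable function [v]. *)
Let F_bound n : exists C : R, forall y, `|F n y| <= C * v y.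
Proof.
exists (1 + 4 ^+ n.+1 * n.+1`!%:R) => y.
rewrite /F /w /v; set t := z y.
have t0 : 0 <= t ^+ 2 / 4 by rewrite divr_ge0// sqr_ge0.
have E : expR (- t ^+ 2 / 4) = expR (t ^+ 2 / 4) * expR (- t ^+ 2 / 2).
  by rewrite -expRD; congr expR; field.
rewrite E mulrA normrM (ger0_norm (expR_ge0 _)) ler_pM2r ?expR_gt0//.
rewrite normrX; pose u : R := `|t|; rewrite -/u.
have u0 : 0 <= u by exact: normr_ge0.
have -> : t ^+ 2 = u ^+ 2 by rewrite /u -normrX ger0_norm// sqr_ge0.
have un : u ^+ n <= 1 + (u ^+ 2) ^+ n.+1.
  have [u1|u1] := leP u 1.
    by rewrite (le_trans (exprn_ile1 n u0 u1))// lerDl exprn_ge0// sqr_ge0.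
  rewrite -[leLHS]add0r lerD// -exprM ler_weXn2l ?ltW//.
  by rewrite mul2n -addnn addSn addnS -addSn ltnW// ltnS leqW// leq_addr.
apply: (le_trans un); rewrite mulrDl mul1r lerD//.
  by rewrite -expR0 ler_expR divr_ge0// sqr_ge0.
rewrite -mulrA -ler_pdivrMl ?exprn_gt0//.
have t0' : 0 <= u ^+ 2 / 4 by rewrite divr_ge0// sqr_ge0.
have f0 : 0 < n.+1`!%:R :> R by rewrite ltr0n fact_gt0.
rewrite mulrC -expr_div_n -ler_pdivrMl// mulrC.
by apply: le_trans (expR_ge1Dxn n t0'); rewrite lerDr.
Qed.

Let v_normal : v = normal_fun b (a * Num.sqrt 2).
Proof.
apply/funext => y; rewrite /v /normal_fun; congr expR.
rewrite [(a * _) ^+ 2]exprMn sqr_sqrtr// /z [((y - b) / a) ^+ 2]expr_div_n.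
rewrite -mulr_natl.
by field; rewrite gt_eqF.
Qed.

Let w_normal : w = normal_fun b a.
Proof.
apply/funext => y; rewrite /w /normal_fun; congr expR.
rewrite /z expr_div_n -mulr_natl.
by field; rewrite gt_eqF.
Qed.

Let normal_fun_pdf m s : s != 0 :> R ->
  normal_fun m s = (fun x => (normal_peak s)^-1 * normal_pdf m s x).
Proof.
move=> s0; apply/funext => x; rewrite normal_pdfE// mulKf//.
by rewrite gt_eqF// normal_peak_gt0.
Qed.

Let v_integrable : mu.-integrable [set: R] (EFin \o v).
Proof.
rewrite v_normal normal_fun_pdf; last first.
  by rewrite gt_eqF// mulr_gt0// sqrtr_gt0.
under [X in integrable _ _ X]eq_fun do rewrite /= EFinM.
exact/integrableZl/integrable_normal_pdf.
Qed.

Lemma gauss_integrable n :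
  mu.-integrable [set: R] (fun y => (((y - b) / a) ^+ n *
    expR (- ((y - b) / a) ^+ 2 / 2))%:E).
Proof.
rewrite -[X in integrable _ _ X]/(EFin \o F n).
have [C HC] := F_bound n.
apply: (@le_integrable _ _ _ mu _ measurableT _ (fun y => (C%:E * (v y)%:E)%E)).
- by apply/measurable_EFinP; exact: continuous_measurable_fun.
- move=> y _; rewrite /= lee_fin.
  by apply: (le_trans (HC y)); rewrite ler_norm.
- exact/integrableZl/v_integrable.
Qed.

(** Since |z| |F k| = |F (k+1)| is at most C, it suffices that |z| exceed C / e, which the chosen
    rank ensures. *)
Let F_infty (s : R) k : s != 0 -> F k (s * n%:R) @[n --> \oo] --> (0 : R).
Proof.
move=> s0; have [C HC] := F_bound k.+1.
apply/cvgrPdist_lt => e e0.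
have sg : 0 < `|s| by rewrite normr_gt0.
exists (Num.truncn ((C * a / e + `|b|) / `|s|)).+1 => // n /= nN.
have : (C * a / e + `|b|) / `|s| < n%:R.
  by apply: (lt_le_trans (truncnS_gt _)); rewrite ler_nat.
rewrite ltr_pdivrMr// -ltrBrDr => H.
have z1 : C < `|z (s * n%:R)| * e.
  rewrite /z normrM normfV (gtr0_norm a0) -ltr_pdivrMr// ltr_pdivlMr//.
  rewrite mulrAC (lt_le_trans H)//.
  rewrite lerBlDr; apply: (@le_trans _ _ `|(s * n%:R - b) + b|).
    by rewrite subrK normrM mulrC [`|n%:R|]ger0_norm.
  exact: ler_normD.
have zp : 0 < `|z (s * n%:R)|.
  rewrite normr_gt0; apply/eqP => z0; move: z1 (HC (s * n%:R)).
  rewrite /F z0 normr0 exprS !mul0r normr0 pmulr_lge0 ?expR_gt0// => C0.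
  by rewrite leNgt C0.
rewrite sub0r normrN -(ltr_pM2l zp) (le_lt_trans _ z1)//.
rewrite -normrM /F mulrA -exprS (le_trans (HC _))//.
have C0 : 0 <= C.
  have := le_trans (normr_ge0 _) (HC 0).
  by rewrite pmulr_lge0 ?expR_gt0.
by rewrite ler_piMr// /v -expR0 ler_expR mulNr oppr_le0 divr_ge0// sqr_ge0.
Qed.

Let F_infty_nat k : F k n%:R @[n --> \oo] --> (0 : R).
Proof.
have /(F_infty k) := oner_neq0 R.
by under [X in X @ _ --> _]eq_fun do rewrite mul1r.
Qed.

Let F_infty_opp k : F k (- n%:R) @[n --> \oo] --> (0 : R).
Proof.
have /(F_infty k) : -1 != 0 :> R by rewrite oppr_eq0 oner_neq0.
by under [X in X @ _ --> _]eq_fun do rewrite mulN1r.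
Qed.

Let integral_F1 : (\int[mu]_y (F 1 y)%:E = 0)%E.
Proof.
have c : continuous (fun y => - a^-1 * F 1 y).
  by move=> y; apply: cvgM; [exact: cvg_cst|exact: F_continuous].
have I : mu.-integrable [set: R] (EFin \o (fun y => - a^-1 * F 1 y)).
  have := integrableZl measurableT (- a^-1) (gauss_integrable 1).
  by apply: eq_integrable.
have := integral_derivative_line c F0_derive I (F_infty_nat 0) (F_infty_opp 0).
under eq_integral do rewrite EFinM.
rewrite integralZl//; last exact: (gauss_integrable 1).
move=> /eqP; rewrite mule_eq0 eqe oppr_eq0 invr_eq0 gt_eqF//=.
by move/eqP.
Qed.

(** The derivative of [F n.+1] is a^-1 ((n+1) F n - F (n+2)), and its integral over the line
    vanishes. *)
Let integral_FSS n : (\int[mu]_y (F n.+2 y)%:E =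
   n.+1%:R%:E * \int[mu]_y (F n y)%:E)%E.
Proof.
have c : continuous (fun y => a^-1 * (n.+1%:R * F n y - F n.+2 y)).
  move=> y; apply: cvgM; first exact: cvg_cst.
  apply: cvgB; last exact: F_continuous.
  by apply: cvgM; [exact: cvg_cst|exact: F_continuous].
have I1 : mu.-integrable [set: R] (EFin \o (fun y => n.+1%:R * F n y)).
  have := integrableZl measurableT n.+1%:R (gauss_integrable n).
  by apply: eq_integrable.
have I2 : mu.-integrable [set: R] (EFin \o F n.+2) := gauss_integrable n.+2.
have I3 : mu.-integrable [set: R]
    (EFin \o (fun y => n.+1%:R * F n y - F n.+2 y)).
  by have := integrableB measurableT I1 I2; apply: eq_integrable.
have I : mu.-integrable [set: R]
    (EFin \o (fun y => a^-1 * (n.+1%:R * F n y - F n.+2 y))).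
  have := integrableZl measurableT (a^-1) I3.
  by apply: eq_integrable.
have := integral_derivative_line c (FS_derive n) I
  (F_infty_nat n.+1) (F_infty_opp n.+1).
under eq_integral do rewrite EFinM.
rewrite integralZl//.
move=> /eqP; rewrite mule_eq0 eqe invr_eq0 gt_eqF//=.
under eq_integral do rewrite EFinB.
rewrite integralB_EFin//.
have f1 := integrable_fin_num measurableT I1.
have f2 := integrable_fin_num measurableT I2.
move: f1 f2 => /= f1 f2.
rewrite -(fineK f1) -(fineK f2) -EFinB eqe subr_eq0 => /eqP <-.
rewrite fineK//.
under eq_integral do rewrite EFinM.
by rewrite integralZl//; exact: (gauss_integrable n).
Qed.

Lemma gauss_integral n :
  (\int[mu]_y (((y - b) / a) ^+ n * expR (- ((y - b) / a) ^+ 2 / 2))%:E =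
    (a * Num.sqrt (2 * pi) * gauss_moment n)%:E)%E.
Proof.
rewrite -[LHS]/(\int[mu]_y (F n y)%:E)%E.
suff : (\int[mu]_y (F n y)%:E = (a * Num.sqrt (2 * pi) * gauss_moment n)%:E)%E /\
  (\int[mu]_y (F n.+1 y)%:E = (a * Num.sqrt (2 * pi) * gauss_moment n.+1)%:E)%E.
  by case.
elim: n => [|n [IH1 IH2]]; split => //.
- rewrite /F; under eq_integral do rewrite expr0 mul1r.
  rewrite w_normal normal_fun_pdf ?gt_eqF//.
  under eq_integral do rewrite EFinM.
  rewrite integralZl//; last exact: integrable_normal_pdf.
  rewrite integral_normal_pdf mule1 /normal_peak invrK mulr1; congr EFin.
  rewrite -mulrnAr -mulr_natl sqrtrM ?sqr_ge0// sqrtr_sqr gtr0_norm//.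
- by rewrite integral_F1 mulr0.
- rewrite integral_FSS IH1 gauss_momentSS -EFinM; congr EFin.
  by rewrite mulrCA.
Qed.

End GaussianMoments.

(** * Iterated Lebesgue measure and triangular substitutions *)

Section LebesgueTuple.
Variable R : realType.
Notation mu := (@lebesgue_measure R).

(* No measurability is required: the integral of a nonnegative function is a
   supremum over the simple functions below it. *)
Lemma ge0_le_integral_nonmeasurable d (T : measurableType d)
    (m : {measure set T -> \bar R}) (f g : T -> \bar R) :
  (forall x, 0 <= f x)%E -> (forall x, f x <= g x)%E ->
  (\int[m]_x f x <= \int[m]_x g x)%E.
Proof.
move=> f0 fg.
have g0 x : (0 <= g x)%E := le_trans (f0 x) (fg x).
rewrite !ge0_integralTE//; apply: ereal_sup_le => /=.
by move=> _ [h hf <-]; exists h => // x; exact: le_trans (hf x) (fg x).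
Qed.

Lemma lebesgue_tupleS N (B : set (N.+1.-tuple R)) :
  lebesgue_tuple B =
  (\int[mu]_y lebesgue_tuple [set t | B (cons_tuple y t)])%E.
Proof.
rewrite /= /product_measure1; apply: eq_integral => y _ /=; congr lebesgue_tuple.
by apply/seteqP; split => t /=; rewrite /xsection/= inE.
Qed.

Lemma lebesgue_tuple_ge0 N (B : set (N.-tuple R)) : (0 <= lebesgue_tuple B)%E.
Proof.
elim: N B => [|N IH] B; first by rewrite /= diracE lee_fin.
by rewrite lebesgue_tupleS; apply: integral_ge0 => y _; exact: IH.
Qed.

Lemma le_lebesgue_tuple N (B C : set (N.-tuple R)) :
  B `<=` C -> (lebesgue_tuple B <= lebesgue_tuple C)%E.
Proof.
elim: N B C => [|N IH] B C BC.
  rewrite /= !diracE lee_fin ler_nat; have [|//] := boolP (_ \in B).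
  by rewrite inE => /BC H; rewrite mem_set.
rewrite !lebesgue_tupleS; apply: ge0_le_integral_nonmeasurable => y.
  exact: lebesgue_tuple_ge0.
by apply: IH => t /=; exact: BC.
Qed.

Definition gauss_weight N (t : N.-tuple R) : R :=
  expR (- (\sum_i tnth t i ^+ 2) / 2).

(* A change of variables that the iterated integral follows one coordinate at a
   time, without a Jacobian formula. *)
Definition triangular N (al : 'I_N -> R) (Phi : N.-tuple R -> N.-tuple R) :=
  exists h : 'I_N -> N.-tuple R -> R,
    (forall (i : 'I_N) (t t' : N.-tuple R),
      (forall j : 'I_N, (j < i)%N -> tnth t j = tnth t' j) ->
      h i t = h i t') /\
    (forall t i, tnth (Phi t) i = al i * tnth t i + h i t).

Lemma gauss_weight_cons N y (t : N.-tuple R) :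
  gauss_weight (cons_tuple y t) = expR (- y ^+ 2 / 2) * gauss_weight t.
Proof.
rewrite /gauss_weight -expRD big_ord_recl tnth0; congr expR.
under eq_bigr do rewrite tnthS.
by rewrite opprD mulrDl.
Qed.

Lemma triangular_cons N (al : 'I_N.+1 -> R) Phi : triangular al Phi ->
  exists b (Phi' : R -> N.-tuple R -> N.-tuple R),
    (forall x, triangular (fun i => al (lift ord0 i)) (Phi' x)) /\
    (forall x t, Phi (cons_tuple x t) = cons_tuple (al ord0 * x + b) (Phi' x t)).
Proof.
move=> [h [hl hP]].
(* [h ord0] depends on no coordinate, so its value at the zero tuple is its only value. *)
exists (h ord0 (nseq_tuple _ 0)), (fun x t => behead_tuple (Phi (cons_tuple x t))).
split.
  move=> x; exists (fun i t => h (lift ord0 i) (cons_tuple x t)); split.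
    move=> i t t' tt'; apply: hl => j.
    have [k ->|->] := unliftP ord0 j; last by rewrite !tnth0.
    by rewrite !tnthS => ki; apply: tt'.
  move=> t i; rewrite tnth_behead -(tnthS x t i) -hP; congr tnth.
  by apply/val_inj; rewrite /= inordK// ltnS ltn_ord.
move=> x t; apply: eq_from_tnth => i.
have [k ->|->] := unliftP ord0 i.
  rewrite tnthS tnth_behead; congr tnth; apply/val_inj.
  by rewrite /= inordK// ltnS ltn_ord.
by rewrite tnth0 hP tnth0; congr (_ + _); apply: hl.
Qed.

(** The Gaussian weight is a product over coordinates. On the slice at [y = al ord0 * x + b] the
    factor exp(-x^2 / 2) joins the constant [c], and its integral in [y] then produces [al ord0]
    times the square root of 2 pi. *)
Lemma lebesgue_tuple_gauss_ub N (al : 'I_N -> R) Phi (B : set (N.-tuple R))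
    (c : R) : (forall i, 0 < al i) -> triangular al Phi -> 0 <= c ->
  (forall t, B (Phi t) -> 1 <= c * gauss_weight t) ->
  (lebesgue_tuple B <= (c * (Num.sqrt (2 * pi) ^+ N * \prod_i al i))%:E)%E.
Proof.
elim: N al Phi B c => [|N IH] al Phi B c al0 tri c0 H.
  rewrite /= diracE lee_fin expr0 big_ord0 !mulr1.
  have [|_] := boolP (_ \in B); last by [].
  rewrite inE => B0; have := H [tuple]; rewrite tuple0 => /(_ B0).
  by rewrite /gauss_weight big_ord0 oppr0 mul0r expR0 mulr1.
have [b [Phi' [tri' PhiE]]] := triangular_cons tri.
rewrite lebesgue_tupleS.
pose K := c * (Num.sqrt (2 * pi) ^+ N * \prod_(i < N) al (lift ord0 i)).
pose w y := ((y - b) / al ord0) ^+ 0 * expR (- ((y - b) / al ord0) ^+ 2 / 2).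
apply: (@le_trans _ _ (\int[mu]_y (K%:E * (w y)%:E))%E).
  apply: ge0_le_integral_nonmeasurable => y; first exact: lebesgue_tuple_ge0.
  set x := (y - b) / al ord0.
  have yE : al ord0 * x + b = y by rewrite /x mulrCA divff ?gt_eqF// mulr1 subrK.
  have := IH _ (Phi' x) [set t | B (cons_tuple y t)] (c * w y)
    (fun i => al0 _) (tri' x).
  rewrite /w expr0 mul1r -/x => /(_ _ _)/le_trans; apply.
  - by rewrite mulr_ge0// expR_ge0.
  - move=> t /= Bt; rewrite -mulrA -gauss_weight_cons; apply: H.
    by rewrite PhiE yE.
  - by rewrite -EFinM lee_fin /K [in leRHS]mulrAC.
rewrite integralZl//; last exact: gauss_integrable.
rewrite gauss_integral// -EFinM lee_fin /= mulr1 /K big_ord_recl exprS.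
by rewrite le_eqVlt; apply/orP; left; apply/eqP; ring.
Qed.

(* A polynomial is a list of coefficients and exponents here, so that the
   induction on [N] can integrate out the first variable. *)
Definition peval N (s : seq (R * N.-tuple nat)) (t : N.-tuple R) : R :=
  \sum_(cm <- s) cm.1 * \prod_i tnth t i ^+ tnth cm.2 i.

Definition pexpect N (s : seq (R * N.-tuple nat)) : R :=
  \sum_(cm <- s) cm.1 * \prod_i gauss_moment R (tnth cm.2 i).

(** A minorant that is a polynomial times the weight keeps this form on every slice, the first
    variable moving into the coefficients, so that only one-dimensional Gaussian moments are
    integrated. *)
Lemma lebesgue_tuple_gauss_lb N (al : 'I_N -> R) Phi (B : set (N.-tuple R))
    (s : seq (R * N.-tuple nat)) :
  (forall i, 0 < al i) -> triangular al Phi ->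
  (forall t, peval s t * gauss_weight t <= \1_B (Phi t)) ->
  ((pexpect s * (Num.sqrt (2 * pi) ^+ N * \prod_i al i))%:E <=
     lebesgue_tuple B)%E.
Proof.
elim: N al Phi B s => [|N IH] al Phi B s al0 tri H.
  rewrite /= diracE lee_fin expr0 big_ord0 !mulr1.
  have := H [tuple].
  rewrite (tuple0 (Phi _)) /gauss_weight big_ord0 oppr0 mul0r expR0.
  rewrite mulr1 indicE; apply: le_trans; rewrite le_eqVlt; apply/orP; left.
  by apply/eqP; apply: eq_bigr => cm _; rewrite !big_ord0.
have [b [Phi' [tri' PhiE]]] := triangular_cons tri.
pose K := Num.sqrt (2 * pi) ^+ N * \prod_(i < N) al (lift ord0 i).
pose E (cm : R * N.+1.-tuple nat) :=
  cm.1 * \prod_(i < N) gauss_moment R (tnth cm.2 (lift ord0 i)).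
pose w k y := ((y - b) / al ord0) ^+ k * expR (- ((y - b) / al ord0) ^+ 2 / 2).
pose k y := (\sum_(cm <- s) (K * E cm)%:E * (w (tnth cm.2 ord0) y)%:E)%E.
have intk : (\int[mu]_y k y = (pexpect s * (Num.sqrt (2 * pi) ^+ N.+1 * \prod_i al i))%:E)%E.
  rewrite /k integral_sum//; last first.
    by move=> cm; apply: integrableZl => //; exact: gauss_integrable.
  transitivity (\sum_(cm <- s) (K * E cm *
    (al ord0 * Num.sqrt (2 * pi) * gauss_moment R (tnth cm.2 ord0)))%:E)%E.
    apply: eq_bigr => cm _.
    rewrite integralZl//; last exact: gauss_integrable.
    by rewrite gauss_integral// -EFinM.
  rewrite sumEFin; congr EFin; rewrite /pexpect mulr_suml; apply: eq_bigr => cm _.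
  by rewrite /K /E !big_ord_recl exprS; ring.
(* The slice bound [k y] may be negative. As measures are not, it can be replaced by its positive
   part, and nonnegative functions are compared. *)
rewrite -intk integralE lebesgue_tupleS.
apply: (@le_trans _ _ (\int[mu]_y (k^\+ y))%E).
  by rewrite -[leRHS]adde0 leeD// oppe_le0 integral_ge0.
apply: ge0_le_integral_nonmeasurable => // y.
rewrite funeposE ge_max lebesgue_tuple_ge0 andbT.
pose x := (y - b) / al ord0.
have yE : al ord0 * x + b = y by rewrite /x mulrCA divff ?gt_eqF// mulr1 subrK.
pose sx : seq (R * N.-tuple nat) :=
  [seq (cm.1 * w (tnth cm.2 ord0) y, behead_tuple cm.2) | cm <- s].
have := IH _ (Phi' x) [set t | B (cons_tuple y t)] sx (fun i => al0 _) (tri' x).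
have tb (t : N.+1.-tuple nat) i : tnth (behead_tuple t) i = tnth t (lift ord0 i).
  rewrite tnth_behead; congr tnth; apply/val_inj.
  by rewrite /= inordK// ltnS ltn_ord.
move=> IHx; apply: le_trans (IHx _) => [|t].
- rewrite /k /pexpect big_map.
  rewrite (eq_bigr (fun cm => (K * E cm * w (tnth cm.2 ord0) y)%:E)); last first.
    by move=> cm _; rewrite [in RHS]EFinM.
  rewrite sumEFin lee_fin mulr_suml le_eqVlt; apply/orP; left; apply/eqP.
  apply: eq_bigr => cm _; rewrite /E /=.
  by under [in RHS]eq_bigr do rewrite tb; rewrite /K; ring.
- apply: le_trans (le_trans (H (cons_tuple x t)) _); last first.
    rewrite PhiE yE !indicE ler_nat; have [|//] := boolP (_ \in B).
    by rewrite inE => BP; rewrite mem_set.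
  rewrite gauss_weight_cons mulrA ler_pM2r ?expR_gt0// /peval big_map mulr_suml.
  rewrite le_eqVlt; apply/orP; left; apply/eqP.
  apply: eq_bigr => cm _; rewrite big_ord_recl /= tnth0.
  under [in RHS]eq_bigr do rewrite tnthS; under eq_bigr do rewrite tb.
  by rewrite /w -/x; ring.
Qed.

End LebesgueTuple.

(** * Gaussian expectation of polynomials *)

Section GaussianExpectation.
Variables (R : realType) (N : nat).
Notation C := R[i].
Notation P := (mpoly N C).
Notation gm := (gauss_moment R).

Definition mexpect (p : P) : C :=
  \sum_(m <- msupp p) mcoeff m p * (\prod_i gm (m i))%:C.

Let mexpect_widen (p : P) s : uniq s -> {subset msupp p <= s} ->
  mexpect p = \sum_(m <- s) mcoeff m p * (\prod_i gm (m i))%:C.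
Proof.
move=> us sub; rewrite (bigID (mem (msupp p))) /= [X in _ + X]big1 ?addr0.
  rewrite -big_filter; apply: perm_big; apply: uniq_perm.
  - exact: msupp_uniq.
  - exact: filter_uniq.
  - by move=> m; rewrite mem_filter; case: (boolP (m \in _)) => // /sub ->.
by move=> m mp; rewrite memN_msupp_eq0// mul0r.
Qed.

Fact mexpect_is_scalar : scalar mexpect.
Proof.
move=> a p q.
pose s := undup (msupp p ++ msupp q ++ msupp (a *: p + q)).
have us : uniq s := undup_uniq _.
rewrite (@mexpect_widen p s us) => [|m mp]; last by rewrite mem_undup !mem_cat mp.
rewrite (@mexpect_widen q s us) => [|m mp]; last first.
  by rewrite mem_undup !mem_cat mp orbT.
rewrite (@mexpect_widen (a *: p + q) s us) => [|m mp]; last first.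
  by rewrite mem_undup !mem_cat mp !orbT.
rewrite mulr_sumr -big_split /=; apply: eq_bigr => m _.
by rewrite mcoeffD mcoeffZ; ring.
Qed.

HB.instance Definition _ := @GRing.isLinear.Build C P C _ mexpect mexpect_is_scalar.

Lemma mexpect1 : mexpect 1 = 1.
Proof.
rewrite /mexpect msupp1 big_seq1 mcoeff1 eqxx mul1r big1//.
by move=> i _; rewrite mnm0E.
Qed.

Lemma mexpectX m : mexpect (mpolyX C m) = (\prod_i gm (m i))%:C.
Proof. by rewrite /mexpect msuppX big_seq1 mcoeffX eqxx mul1r. Qed.

(** On a monomial this is the recursion of [gauss_moment] in the exponent of the i-th variable; for
    exponent 0 both sides vanish, the first moment being 0. *)
Lemma mexpect_stein i (p : P) :
  mexpect (mpolyX C (mnm1 i) * p) = mexpect (mderiv i p).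
Proof.
elim/mpolyind: p => [|c m p _ _ IH]; first by rewrite mulr0 mderiv0.
rewrite mulrDr mderivD !raddfD /= IH; congr (_ + _).
rewrite -scalerAr mderivZ !linearZ /=; congr (_ * _).
rewrite -mpolyXD mexpectX mderivX linearZ /= mexpectX.
rewrite (bigD1 i)//= [in RHS](bigD1 i)//=.
rewrite mnmDE mnm1E eqxx mnmBE mnm1E eqxx.
under eq_bigr => j ji do rewrite mnmDE mnm1E eq_sym (negbTE ji) add0n.
under [in RHS]eq_bigr => j ji do rewrite mnmBE mnm1E eq_sym (negbTE ji) subn0.
case: (m i) => [|k]; first by rewrite /= mul0r mulr0n mul0r.
rewrite [(true + _)%N]add1n [(_ - true)%N]subn1 gauss_momentSS /=.
by rewrite -(rmorph_nat (real_complex R)) -rmorphM /= mulrA.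
Qed.

(** Matrix entries force complex coefficients, but moments and points are real, so real parts can be
    taken coefficientwise. This leads back to the lists used in the lower bound. *)
Lemma pexpect_mexpect (p : P) :
  pexpect [seq (complex.Re (mcoeff m p), multinom_val m) | m <- msupp p] =
  complex.Re (mexpect p).
Proof.
rewrite /pexpect big_map /mexpect raddf_sum; apply: eq_bigr => m _ /=.
by case: (mcoeff m p) => a b /=; rewrite mulr0 subr0.
Qed.

Definition rval (t : N.-tuple R) (i : 'I_N) : C := (tnth t i)%:C.

Lemma peval_meval (p : P) t :
  peval [seq (complex.Re (mcoeff m p), multinom_val m) | m <- msupp p] t =
  complex.Re (meval (rval t) p).
Proof.
rewrite /peval big_map mevalE raddf_sum; apply: eq_bigr => m _ /=.
have -> : \prod_i rval t i ^+ m i = (\prod_i tnth t i ^+ m i)%:C.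
  by rewrite rmorph_prod; apply: eq_bigr => i _; rewrite rmorphXn.
by case: (mcoeff m p) => a b /=; rewrite mulr0 subr0.
Qed.

End GaussianExpectation.

(** * Schwinger-Dyson equations *)

Section Splits.
Variable I : Type.
Implicit Types w : seq I.

(** The triples [(u, l, v)] with w = u l v: the possible partners [l] of a letter placed in front of
    [w]. *)
Fixpoint splits w : seq (seq I * I * seq I) :=
  if w is l :: w' then
    ([::], l, w') :: [seq (l :: s.1.1, s.1.2, s.2) | s <- splits w']
  else [::].

(** Each occurrence together with the remaining list; it selects the trace factor that a derivative
    hits. *)
Fixpoint picks (l : seq I) : seq (I * seq I) :=
  if l is x :: l' then (x, l') :: [seq (q.1, x :: q.2) | q <- picks l']
  else [::].

End Splits.

Lemma picks_map (I J : Type) (f : I -> J) l :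
  picks [seq f x | x <- l] = [seq (f q.1, map f q.2) | q <- picks l].
Proof. by elim: l => //= x l ->; rewrite -!map_comp. Qed.

Lemma big_picks (S : Type) (idx : S) (op : Monoid.com_law idx) (I : eqType)
    (f : I -> S) (l : seq I) q : q \in picks l ->
  \big[op/idx]_(x <- l) f x = op (f q.1) (\big[op/idx]_(x <- q.2) f x).
Proof.
elim: l q => [|x l IH] //= q; rewrite inE => /orP[/eqP->|/mapP[q' /IH E ->]].
  by rewrite big_cons.
by rewrite /= !big_cons E Monoid.mulmCA.
Qed.

Lemma size_splits (I : eqType) (w : seq I) s :
  s \in splits w -> (size s.1.1 + size s.2).+1 = size w.
Proof.
elim: w s => [|l w IH] //= s; rewrite inE => /orP[/eqP->//|/mapP[s' /IH E ->]].
by rewrite /= addSn E.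
Qed.

Lemma splits_nseq (I : Type) (k : I) n :
  splits (nseq n k) = [seq (nseq j k, k, nseq (n.-1 - j) k) | j <- iota 0 n].
Proof.
elim: n => //= n ->; rewrite subn0; congr (_ :: _).
rewrite (iotaDl 1 0 n) -!map_comp; apply/eq_in_map => j.
by rewrite mem_iota /= => jn; congr (_, _, nseq _ _); lia.
Qed.

Section SchwingerDyson.
Variables (C : comNzRingType) (P : comAlgType C) (E : {scalar P}).
Variables (I : Type) (d : nat) (X : I -> 'M[P]_d) (a : I -> I -> C).
Variable (D : I -> 'I_d -> 'I_d -> P -> P).
Hypothesis D_add : forall k i j p q, D k i j (p + q) = D k i j p + D k i j q.
Hypothesis D_mul : forall k i j p q, D k i j (p * q) = D k i j p * q + p * D k i j q.
Hypothesis D_X : forall k i j l x y,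
  D k i j (X l x y) = a k l *: ((i == y) && (j == x))%:R.
Hypothesis stein : forall k i j f, E (X k i j * f) = E (D k i j f).

Definition mxword (w : seq I) : 'M[P]_d := \prod_(k <- w) X k.
Definition trword (w : seq I) : P := \tr (mxword w).
Definition trwords (ws : seq (seq I)) : P := \prod_(w <- ws) trword w.

Let D0 k i j : D k i j 0 = 0.
Proof. by apply: (addrI (D k i j 0)); rewrite -D_add !addr0. Qed.

Let D1 k i j : D k i j 1 = 0.
Proof.
apply: (addrI (D k i j 1)); rewrite addr0.
by rewrite -{3}[1]mulr1 D_mul mul1r mulr1.
Qed.

Let D_sum k i j (J : Type) (r : seq J) (f : J -> P) :
  D k i j (\sum_(x <- r) f x) = \sum_(x <- r) D k i j (f x).
Proof. by apply: big_morph; [exact: D_add|exact: D0]. Qed.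

Lemma D_mxword k i j w x y : D k i j (mxword w x y) =
  \sum_(s <- splits w) a k s.1.2 *: (mxword s.1.1 x j * mxword s.2 i y).
Proof.
elim: w x => [|l w IH] x.
  by rewrite /mxword !big_nil mxE; case: (x == y); rewrite ?D0 ?D1.
rewrite /= big_cons big_map /=.
transitivity (\sum_z D k i j (X l x z * mxword w z y)).
  by rewrite /mxword big_cons mxE D_sum.
under [LHS]eq_bigr do rewrite D_mul D_X.
rewrite big_split /=; congr (_ + _).
  have -> : mxword [::] = 1 by rewrite /mxword big_nil.
  rewrite [(1 : 'M[P]_d) x j]mxE (bigD1 i)//= eqxx big1 ?addr0 => [|z zi].
    by rewrite eq_sym -scalerAl; case: (x == j).
  by rewrite eq_sym (negbTE zi) scaler0 mul0r.
under eq_bigr => z _ do rewrite IH mulr_sumr.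
rewrite exchange_big /=; apply: eq_bigr => s _.
rewrite [in RHS]/mxword big_cons mxE mulr_suml scaler_sumr.
by apply: eq_bigr => z _; rewrite -scalerAr mulrA.
Qed.

Lemma D_trword k i j w : D k i j (trword w) =
  \sum_(s <- splits w) a k s.1.2 *: (mxword s.2 * mxword s.1.1) i j.
Proof.
rewrite /trword /mxtrace D_sum.
under eq_bigr => x _ do rewrite D_mxword.
rewrite exchange_big /=; apply: eq_bigr => s _.
rewrite -scaler_sumr mxE; congr (_ *: _).
by apply: eq_bigr => x _; rewrite mulrC.
Qed.

Lemma D_trwords k i j ws : D k i j (trwords ws) =
  \sum_(q <- picks ws) D k i j (trword q.1) * trwords q.2.
Proof.
elim: ws => [|w ws IH]; first by rewrite /trwords !big_nil D1.
rewrite /= big_cons /= big_map /= {1}/trwords big_cons D_mul; congr (_ + _).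
rewrite -/(trwords ws) IH mulr_sumr; apply: eq_bigr => q _.
by rewrite [in RHS]/trwords big_cons mulrCA.
Qed.

Lemma mxword_cat u v : mxword (u ++ v) = mxword u * mxword v.
Proof. by rewrite /mxword big_cat. Qed.

(** The first letter is written out in entries and integrated by parts. A derivative that hits the
    rest of its own word cuts the trace in two; one that hits another trace merges the two words
    into one. *)
Lemma schwinger_dyson k w ws :
  E (trwords ((k :: w) :: ws)) =
  \sum_(s <- splits w) a k s.1.2 * E (trwords [:: s.1.1, s.2 & ws]) +
  \sum_(q <- picks ws) \sum_(s <- splits q.1)
     a k s.1.2 * E (trwords ((w ++ s.2 ++ s.1.1) :: q.2)).
Proof.
have -> : trwords ((k :: w) :: ws) =
    \sum_i \sum_j X k i j * (mxword w j i * trwords ws).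
  rewrite /trwords big_cons -/(trwords ws) /trword /mxtrace mulr_suml.
  apply: eq_bigr => i _; rewrite /mxword big_cons mxE mulr_suml.
  by apply: eq_bigr => j _; rewrite mulrA.
transitivity (\sum_i \sum_j (E (D k i j (mxword w j i) * trwords ws) +
    E (mxword w j i * D k i j (trwords ws)))).
  rewrite raddf_sum; apply: eq_bigr => i _.
  rewrite raddf_sum; apply: eq_bigr => j _.
  by rewrite /= stein D_mul; exact: raddfD.
under [LHS]eq_bigr do rewrite big_split /=.
rewrite big_split /=; congr (_ + _).
  transitivity (\sum_i \sum_j \sum_(s <- splits w)
      a k s.1.2 * E (mxword s.1.1 j j * mxword s.2 i i * trwords ws)).
    apply: eq_bigr => i _; apply: eq_bigr => j _.
    rewrite D_mxword mulr_suml raddf_sum; apply: eq_bigr => s _ /=.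
    by rewrite -scalerAl linearZ.
  under [LHS]eq_bigr => i _ do rewrite exchange_big /=.
  rewrite exchange_big /=; apply: eq_bigr => s _.
  rewrite /trwords !big_cons -/(trwords ws) /trword /mxtrace.
  rewrite exchange_big /= mulr_suml raddf_sum mulr_sumr.
  apply: eq_bigr => i _ /=.
  rewrite mulr_suml mulr_sumr raddf_sum mulr_sumr; apply: eq_bigr => j _ /=.
  by rewrite mulrA.
transitivity (\sum_i \sum_j \sum_(q <- picks ws) \sum_(s <- splits q.1)
    a k s.1.2 * E (mxword w j i * (mxword s.2 * mxword s.1.1) i j * trwords q.2)).
  apply: eq_bigr => i _; apply: eq_bigr => j _.
  rewrite D_trwords mulr_sumr raddf_sum; apply: eq_bigr => q _ /=.
  rewrite D_trword mulr_suml mulr_sumr raddf_sum; apply: eq_bigr => s _ /=.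
  by rewrite -scalerAl -scalerAr linearZ /= mulrA.
under [LHS]eq_bigr => i _ do rewrite exchange_big /=.
rewrite exchange_big /=; apply: eq_bigr => q _.
under [LHS]eq_bigr => i _ do rewrite exchange_big /=.
rewrite exchange_big /=; apply: eq_bigr => s _.
rewrite /trwords big_cons -/(trwords q.2) /trword mxword_cat mxword_cat.
rewrite /mxtrace exchange_big /= mulr_suml raddf_sum mulr_sumr.
apply: eq_bigr => j _ /=.
rewrite mxE mulr_suml raddf_sum mulr_sumr; apply: eq_bigr => i _ /=.
by [].
Qed.

End SchwingerDyson.

(** * Semicircular moments as limits of mean traces *)

Lemma cvg_sum_seq (R : realType) (J : eqType) (r : seq J) (f : J -> nat -> R) (g : J -> R) :
  (forall x, x \in r -> f x d @[d --> \oo] --> g x) ->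
  \sum_(x <- r) f x d @[d --> \oo] --> \sum_(x <- r) g x.
Proof.
elim: r => [|x r IH] H.
  rewrite big_nil; under eq_cvg do rewrite big_nil; exact: cvg_cst.
rewrite big_cons; under eq_cvg do rewrite big_cons.
apply: cvgD; first by apply: H; rewrite mem_head.
by apply: IH => y yr; apply: H; rewrite inE yr orbT.
Qed.

Section FreeMoments.
Variables (R : realType) (I : eqType) (A : I -> I -> R).
Implicit Types (w : seq I) (ws : seq (seq I)).

(** The recursion descends to both parts of a split, which are shorter but not structural subterms;
    the length of the word is enough fuel. *)
Fixpoint free_moment_fuel (n : nat) w : R :=
  match n, w with
  | _, [::] => 1
  | 0, _ => 0
  | n'.+1, k :: w' => \sum_(s <- splits w') A k s.1.2 *
      (free_moment_fuel n' s.1.1 * free_moment_fuel n' s.2)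
  end.

Definition free_moment w := free_moment_fuel (size w) w.

Let free_moment_fuelE n w : (size w <= n)%N ->
  free_moment_fuel n w = free_moment w.
Proof.
rewrite /free_moment; have [m] := ubnP (size w); move: w n.
elim: m => // m IH [|k w] [|n] //= wm wn.
rewrite !big_seq; apply: eq_bigr => [[[u l] v]] /size_splits /= sE.
have F x : (size x < size w)%N ->
    free_moment_fuel n x = free_moment_fuel (size w) x.
  by move=> xw; rewrite (IH _ n) ?(IH _ (size w))//; lia.
by rewrite !F//; lia.
Qed.

Lemma free_moment_nil : free_moment [::] = 1. Proof. by []. Qed.

Lemma free_moment_cons k w : free_moment (k :: w) =
  \sum_(s <- splits w) A k s.1.2 * (free_moment s.1.1 * free_moment s.2).
Proof.
rewrite {1}/free_moment /= !big_seq; apply: eq_bigr => [[[u l] v]] /size_splits /= sE.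
by rewrite !free_moment_fuelE//; lia.
Qed.

Variable mu : nat -> seq (seq I) -> R.
Hypothesis mu0 : forall d, (0 < d)%N -> mu d [::] = 1.
Hypothesis mu_nil : forall d ws, (0 < d)%N -> mu d ([::] :: ws) = mu d ws.
Hypothesis mu_cons : forall d k w ws, (0 < d)%N -> mu d ((k :: w) :: ws) =
  \sum_(s <- splits w) A k s.1.2 * mu d [:: s.1.1, s.2 & ws] +
  (d%:R ^+ 2)^-1 * \sum_(q <- picks ws) \sum_(s <- splits q.1)
     A k s.1.2 * mu d ((w ++ s.2 ++ s.1.1) :: q.2).

(** The merged terms carry 1 / d^2, so the limits satisfy the recursion of [free_moment] on the
    first word. The limit is multiplicative in the words, and this is also what makes the variance
    of a trace vanish. *)
Lemma cvg_mean_traces ws :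
  mu d ws @[d --> \oo] --> \prod_(w <- ws) free_moment w.
Proof.
(* Twice the length plus one: the total drops when an empty word is discarded, and also when a word
   loses two letters but becomes two words. *)
have [n] := ubnP (\sum_(w <- ws) (size w).*2.+1)%N.
elim: n ws => // n IH [_|[|k w] ws].
- rewrite big_nil; apply: cvg_near_cst; exists 1%N => // d /= d0; exact: mu0.
- rewrite big_cons /= => W; rewrite big_cons free_moment_nil mul1r.
  apply: (cvg_trans _ (IH ws _)); last by lia.
  by apply: near_eq_cvg; exists 1%N => // d /= d0; rewrite mu_nil.
rewrite big_cons /= => W.
rewrite big_cons free_moment_cons.
have c1 : (\sum_(s <- splits w) A k s.1.2 * mu d [:: s.1.1, s.2 & ws])
    @[d --> \oo] --> \sum_(s <- splits w) A k s.1.2 *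
      \prod_(v <- [:: s.1.1, s.2 & ws]) free_moment v.
  apply: (@cvg_sum_seq _ _ _ (fun s d => A k s.1.2 * mu d [:: s.1.1, s.2 & ws])).
  move=> - [[u l] v] /size_splits /= sE; apply: cvgM; first exact: cvg_cst.
  by apply: IH; rewrite !big_cons; lia.
have c2 : (\sum_(q <- picks ws) \sum_(s <- splits q.1)
     A k s.1.2 * mu d ((w ++ s.2 ++ s.1.1) :: q.2)) @[d --> \oo] -->
     \sum_(q <- picks ws) \sum_(s <- splits q.1)
     A k s.1.2 * \prod_(v <- (w ++ s.2 ++ s.1.1) :: q.2) free_moment v.
  apply: (@cvg_sum_seq _ _ _ (fun q d => \sum_(s <- splits q.1)
     A k s.1.2 * mu d ((w ++ s.2 ++ s.1.1) :: q.2))) =>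
     - [q1 q2] /(big_picks addn (fun w : seq I => (size w).*2.+1)) /= qE.
  apply: (@cvg_sum_seq _ _ _ (fun s d =>
     A k s.1.2 * mu d ((w ++ s.2 ++ s.1.1) :: q2))) => - [[u l] v] /size_splits /= sE.
  apply: cvgM; first exact: cvg_cst.
  by apply: IH; rewrite !big_cons !size_cat; lia.
have c0 : ((d%:R : R) ^+ 2)^-1 @[d --> \oo] --> (0 : R).
  have -> : (fun d : nat => ((d%:R : R) ^+ 2)^-1) = (fun d => d%:R^-1 * d%:R^-1).
    by apply/funext => d; rewrite expr2 invfM.
  have h : (d%:R : R)^-1 @[d --> \oo] --> (0 : R).
    by apply/gtr0_cvgV0; [exists 1%N => // d /= d0; rewrite ltr0n|exact: cvgr_idn].
  by rewrite -[X in _ --> X](mulr0 0); exact: cvgM.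
have -> : (\sum_(s <- splits w) A k s.1.2 *
      (free_moment s.1.1 * free_moment s.2)) * \prod_(v <- ws) free_moment v =
    \sum_(s <- splits w) A k s.1.2 *
      \prod_(v <- [:: s.1.1, s.2 & ws]) free_moment v.
  by rewrite mulr_suml; apply: eq_bigr => s _; rewrite !big_cons !mulrA.
have := cvgM c0 c2; rewrite mul0r => /(_ _) c02.
have := cvgD c1 c02; rewrite addr0 => /(_ _).
apply: cvg_trans; apply: near_eq_cvg.
by exists 1%N => // d /= d0; rewrite mu_cons.
Qed.

(* The weights [8 ^ n / (n + 1) ^ 2] beat the Catalan convolution by a factor 2,
   which leaves room for the non-planar terms as long as K ^ 3 <= d ^ 2. *)
Let wgt (n : nat) : R := 8 ^+ n / n.+1%:R ^+ 2.

Let wgt_gt0 n : 0 < wgt n.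
Proof. by rewrite divr_gt0// exprn_gt0// ltr0n. Qed.

Let sum_inv_sq n : \sum_(j < n) (j.+1%:R ^+ 2)^-1 <= 2 :> R.
Proof.
(* The strengthening is inductive because 1 / (x+1)^2 <= 1/x - 1/(x+1). *)
suff H m : \sum_(j < m.+1) (j.+1%:R ^+ 2)^-1 <= 2 - m.+1%:R^-1 :> R.
  case: n => [|n]; first by rewrite big_ord0.
  by apply: le_trans (H n) _; rewrite gerBl invr_ge0.
elim: m => [|m IH]; first by rewrite big_ord_recr big_ord0 /=; lra.
rewrite big_ord_recr /=.
have m0 : 0 < m.+1%:R :> R by rewrite ltr0n.
apply: (le_trans (lerD IH (lexx _))).
have -> : m.+2%:R = m.+1%:R + 1 :> R by rewrite -natr1.
move: (m.+1%:R : R) m0 => x x0.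
rewrite -subr_ge0.
have -> : 2 - (x + 1)^-1 - (2 - x^-1 + ((x + 1) ^+ 2)^-1) = (x * (x + 1) ^+ 2)^-1.
  by field; rewrite !gt_eqF// ltr_wpDr.
by rewrite invr_ge0 mulr_ge0 ?sqr_ge0 ?ltW.
Qed.

Let wgt_convolution n :
  \sum_(j < n) wgt j * wgt (n.-1 - j) <= wgt n.+1 / 2.
Proof.
case: n => [|n]; first by rewrite big_ord0 ltW// divr_gt0.
pose f (j : nat) : R := (j.+1%:R ^+ 2)^-1.
(* With x = j + 1 and y = n - j + 1 this is (x + y + 1)^2 <= 8 (x^2 + y^2). Each of the two
   resulting sums of inverse squares is at most 2, and 8 (2 + 2) = 8^2 / 2 matches the base 8 of the
   weights. *)
have T (j : 'I_n.+1) : wgt j * wgt (n - j) <=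
    8 ^+ n * (8 / n.+3%:R ^+ 2) * (f j + f (n - j)%N).
  have jn := ltn_ord j.
  have -> : wgt j * wgt (n - j) = 8 ^+ n * (f j * f (n - j)%N).
    rewrite /wgt /f mulrACA -exprD; congr (8 ^+ _ * _); lia.
  rewrite -mulrA ler_pM2l ?exprn_gt0// /f.
  have -> : n.+3%:R = (j.+1%:R + (n - j).+1%:R) + 1 :> R.
    by rewrite -natrD natr1; congr (_%:R); lia.
  have : 1 <= j.+1%:R :> R by rewrite ler1n.
  have : 1 <= (n - j).+1%:R :> R by rewrite ler1n.
  move: (j.+1%:R : R) ((n - j).+1%:R : R) => x y y1 x1.
  have x0 : 0 < x by lra. have y0 : 0 < y by lra.
  have s0 : 0 < (x + y + 1) ^+ 2 by rewrite exprn_gt0//; lra.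
  rewrite -(ler_pM2r (_ : 0 < x ^+ 2 * y ^+ 2 * (x + y + 1) ^+ 2)); last first.
    by rewrite mulr_gt0// mulr_gt0// exprn_gt0.
  have -> : (x ^+ 2)^-1 * (y ^+ 2)^-1 * (x ^+ 2 * y ^+ 2 * (x + y + 1) ^+ 2) =
     (x + y + 1) ^+ 2 by field; rewrite !gt_eqF.
  have -> : 8 / (x + y + 1) ^+ 2 * ((x ^+ 2)^-1 + (y ^+ 2)^-1) *
    (x ^+ 2 * y ^+ 2 * (x + y + 1) ^+ 2) = 8 * (x ^+ 2 + y ^+ 2).
    by field; rewrite !gt_eqF//; lra.
  have := sqr_ge0 (x - y); nra.
apply: (le_trans (ler_sum _ (fun j _ => T j))).
rewrite -mulr_sumr big_split /=.
have -> : \sum_(j < n.+1) f (n - j)%N = \sum_(j < n.+1) f j.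
  rewrite [RHS](reindex_inj rev_ord_inj) /=; apply: eq_bigr => j _.
  by congr f; have := ltn_ord j; lia.
have := sum_inv_sq n.+1; rewrite -/f; move: (\sum_(j < n.+1) f j) => S S2.
rewrite /wgt -mulrA.
have n0 : 0 < n.+3%:R ^+ 2 :> R by rewrite exprn_gt0// ltr0n.
rewrite (_ : 8 ^+ n.+2 / n.+3%:R ^+ 2 / 2 = 8 ^+ n * (8 / n.+3%:R ^+ 2 * 4)); last first.
  by rewrite !exprS; field; rewrite gt_eqF// ltr0n.
rewrite ler_pM2l ?exprn_gt0// ler_pM2l ?divr_gt0//; lra.
Qed.

Let sum_picks (ks : seq nat) :
  (\sum_(q <- picks ks) q.1 = \sum_(j <- ks) j)%N.
Proof.
elim: ks => [|j ks IH] /=; first by rewrite !big_nil.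
by rewrite !big_cons big_map /= IH.
Qed.

(** The factor [c%:R] counts the letters available for a contraction; it also covers [c = 0], where
    [c.-1] is truncated. *)
Let wgt_merge n c : c%:R * wgt (n + c.-1) <= c%:R * (8 ^+ n / 2 * wgt c).
Proof.
case: c => [|c]; first by rewrite !mul0r.
rewrite ler_pM2l ?ltr0n// /wgt /= exprD [8 ^+ c.+1]exprS.
have c0 : 1 <= c.+1%:R :> R by rewrite ler1n.
have n0 : 0 <= n%:R :> R by [].
have -> : (n + c).+1%:R = n%:R + c.+1%:R :> R by rewrite -natrD addnS.
have -> : c.+2%:R = c.+1%:R + 1 :> R by rewrite natr1.
move: (c.+1%:R : R) (n%:R : R) c0 n0 => x y x1 y0.
have -> : 8 ^+ n / 2 * (8 * 8 ^+ c / (x + 1) ^+ 2) =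
  8 ^+ n * 8 ^+ c * (4 / (x + 1) ^+ 2) :> R by field; rewrite gt_eqF//; lra.
rewrite ler_pM2l ?mulr_gt0 ?exprn_gt0//.
rewrite ler_pdivlMr; last by rewrite exprn_gt0//; lra.
rewrite mulrC ler_pdivrMr; last by rewrite exprn_gt0//; lra.
nra.
Qed.

(** Half of the weight of the first word pays for the splits, by [wgt_convolution]. The other half
    pays for the merges: there are as many as letters in the other words, and the division by d^2
    compensates this number. *)
Let mean_traces_le k d (ks : seq nat) : A k k = 1 -> (0 < d)%N ->
  ((\sum_(j <- ks) j).+1 ^ 3 <= d ^ 2)%N ->
  mu d [seq nseq j k | j <- ks] <= \prod_(j <- ks) wgt j.
Proof.
move=> Akk d0; have [n] := ubnP (\sum_(j <- ks) j.*2.+1)%N.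
elim: n ks => // n IH [_ _|[|c] ks].
- by rewrite big_nil mu0.
- rewrite !big_cons /= mu_nil// /wgt expr0 expr1n divr1 mul1r => W K.
  by apply: IH => //; lia.
rewrite !big_cons /= mu_cons// => W K.
rewrite splits_nseq big_map /= -{1}[c]subn0 -/(index_iota 0 c) big_mkord.
have P0 (l : seq nat) : 0 < \prod_(j <- l) wgt j.
  by rewrite prodr_gt0// => j _; exact: wgt_gt0.
have -> : wgt c.+1 * \prod_(j <- ks) wgt j =
  wgt c.+1 / 2 * \prod_(j <- ks) wgt j + wgt c.+1 / 2 * \prod_(j <- ks) wgt j.
  by field.
apply: lerD.
  apply: (@le_trans _ _ ((\sum_(j < c) wgt j * wgt (c.-1 - j)) * \prod_(j <- ks) wgt j)); last first.
    by rewrite ler_pM2r// wgt_convolution.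
  rewrite mulr_suml; apply: ler_sum => j _; rewrite Akk mul1r.
  have := IH [:: val j, (c.-1 - j)%N & ks]; rewrite !big_cons /= mulrA; apply.
    by have := ltn_ord j; lia.
  apply: leq_trans K; rewrite leq_exp2r//.
  by have := ltn_ord j; lia.
rewrite mulrC ler_pdivrMr ?exprn_gt0 ?ltr0n//.
rewrite picks_map big_map /=.
apply: (@le_trans _ _ (\sum_(q <- picks ks) (q.1%:R * (8 ^+ c / 2)) *
    \prod_(j <- ks) wgt j)).
  rewrite [leLHS]big_seq [leRHS]big_seq; apply: ler_sum => /= - [a l] qin /=.
  have lS : (\sum_(j <- ks) j = a + \sum_(j <- l) j)%N.
    exact: (big_picks addn id qin).
  have lW : (\sum_(j <- ks) j.*2.+1 = a.*2.+1 + \sum_(j <- l) j.*2.+1)%N.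
    exact: (big_picks addn (fun j => j.*2.+1) qin).
  rewrite (big_picks *%R wgt qin) /=.
  rewrite splits_nseq big_map /= -{1}[a]subn0 -/(index_iota 0 a) big_mkord.
  apply: (@le_trans _ _ (\sum_(j < a) wgt (c + a.-1) * \prod_(j <- l) wgt j)).
    apply: ler_sum => j _; rewrite Akk mul1r !cat_nseq /ncons -!iterD.
    have := IH ((c + a.-1)%N :: l); rewrite !big_cons /=.
    have ja : (j < a)%N := ltn_ord j.
    have -> : (c + (a.-1 - j) + j = c + a.-1)%N by lia.
    apply; first by lia.
    by apply: leq_trans K; rewrite leq_exp2r//; lia.
  rewrite sumr_const card_ord -[leLHS]mulr_natl [leLHS]mulrA [leRHS]mulrA ler_pM2r//.
  by rewrite -mulrA wgt_merge.
rewrite -!mulr_suml -natr_sum sum_picks [leRHS]mulrAC ler_pM2r//.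
rewrite /wgt exprS.
set K1 := (\sum_(j <- ks) j)%N in K *.
have K2 : K1%:R * c.+2%:R ^+ 2 <= 8 * d%:R ^+ 2 :> R.
  rewrite -!natrX -!natrM ler_nat.
  apply: (@leq_trans ((c.+1 + K1).+1 ^ 3)); last by lia.
  rewrite [(_ ^ 3)%N]expnS; apply: leq_mul; first by lia.
  by rewrite leq_exp2r//; lia.
have c0 : 0 < c.+2%:R ^+ 2 :> R by rewrite exprn_gt0.
rewrite -(ler_pM2r c0) [leRHS](_ : _ = (8 ^+ c / 2) * (8 * d%:R ^+ 2)); last first.
  by field; rewrite gt_eqF// ltr0n.
rewrite [leLHS](_ : _ = (8 ^+ c / 2) * (K1%:R * c.+2%:R ^+ 2)); last by field.
by rewrite ler_pM2l// divr_gt0// exprn_gt0.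
Qed.

Lemma mean_trace_power_le k d n : A k k = 1 -> (0 < d)%N ->
  (n.+1 ^ 3 <= d ^ 2)%N -> mu d [:: nseq n k] <= 8 ^+ n.
Proof.
move=> Akk d0 nd.
have := @mean_traces_le k d [:: n] Akk d0; rewrite !big_seq1 => /(_ nd) /le_trans.
by apply; rewrite /wgt ler_pdivrMr ?exprn_gt0// ler_peMr// expr_ge1// ler1n.
Qed.

End FreeMoments.

(** * Moments on the Fock space *)

Section FockFunctionals.
Variables (R : realType) (I : eqType) (A : I -> I -> R).
Implicit Types (psi : seq I -> R) (w : seq I).

(* A linear functional on the algebraic Fock space is recorded by its values on
   the simple tensors indexed by words; creation plus annihilation acts on such
   functionals by transposition. *)
Definition tail_contract k psi w : R :=
  if w is x :: w' then A k x * psi w' else 0.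

(** The name tells which part of the word survives: the last letter is contracted here, the first
    one in [tail_contract]. *)
Definition head_contract k psi w : R :=
  if rev w is x :: w' then A k x * psi (rev w') else 0.

Definition left_op k psi w : R := psi (k :: w) + tail_contract k psi w.

Definition right_op k psi w : R := psi (rcons w k) + head_contract k psi w.

Definition vacuum_functional w : R := (w == [::])%:R.

Local Notation left_ops := (foldl (fun psi k => left_op k psi)).
Local Notation right_ops := (foldl (fun psi k => right_op k psi)).
Local Notation dlt := vacuum_functional.

Let head_contract_rcons k psi w x :
  head_contract k psi (rcons w x) = A k x * psi w.
Proof. by rewrite /head_contract rev_rcons revK. Qed.

Let left_opD psi1 psi2 k (c : R) :
  left_op k (fun w => psi1 w + c * psi2 w) =
  (fun w => left_op k psi1 w + c * left_op k psi2 w).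
Proof. by apply/funext => -[|x w]; rewrite /left_op/=; ring. Qed.

Let left_opsD psi1 psi2 (c : R) w :
  left_ops (fun w => psi1 w + c * psi2 w) w =
  (fun x => left_ops psi1 w x + c * left_ops psi2 w x).
Proof. by elim: w psi1 psi2 => //= k w IH psi1 psi2; rewrite left_opD IH. Qed.

(** The two ends of a word interact only when nothing lies between them: the commutator is
    concentrated on the empty word, where the new letter [l] is itself the last one. *)
Let left_op_contract k l psi : left_op l (head_contract k psi) =
  (fun w => head_contract k (left_op l psi) w + (A k l * psi [::]) * dlt w).
Proof.
apply/funext => w; case/lastP: w => [|w x].
  by rewrite /left_op /= /head_contract /= addr0 add0r /dlt eqxx mulr1.
rewrite head_contract_rcons /left_op -rcons_cons head_contract_rcons.
rewrite /dlt; case: w => [|y w] /=; first by rewrite /head_contract /=; ring.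
by rewrite head_contract_rcons; ring.
Qed.

(** Both sides are supported on one-letter words, whose first and last letters coincide. The first
    operator thus becomes a contraction at the far end, which can be carried through the later
    operators. *)
Let left_op_vacuum k : left_op k dlt = head_contract k dlt.
Proof.
apply/funext => -[|x w]; first by rewrite /left_op /= add0r.
rewrite /left_op /= /dlt /= add0r; case/lastP: w => [|w y] //=.
by rewrite -rcons_cons head_contract_rcons /= mulr0 -size_eq0 size_rcons mulr0.
Qed.

(** The contraction moves along [w] and may stop at any letter [l], leaving [A k l]: the letters
    before have acted on [psi], those after start from the vacuum again. This is the recursion of
    non-crossing pairings. *)
Let left_ops_contract k w psi : left_ops (head_contract k psi) w [::] =
  \sum_(s <- splits w)
    A k s.1.2 * (left_ops psi s.1.1 [::] * left_ops dlt s.2 [::]).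
Proof.
elim: w psi => [|l w IH] psi /=; first by rewrite big_nil.
rewrite left_op_contract left_opsD IH big_cons big_map /=.
by rewrite addrC mulrA.
Qed.

Lemma left_moment w : left_ops dlt w [::] = free_moment A w.
Proof.
have [n] := ubnP (size w); elim: n w => // n IH [|k w] wn.
  by rewrite /= /dlt eqxx.
rewrite [LHS]/= left_op_vacuum left_ops_contract free_moment_cons.
rewrite big_seq [RHS]big_seq; apply: eq_bigr => /= - [[u l] v] /size_splits /= sE.
by rewrite !IH//; move: wn => /=; lia.
Qed.

Hypothesis A_sym : forall k l, A k l = A l k.

(** On a nonempty word the two ends do not interfere; on the empty word the two sides contain
    [A l k] and [A k l], equal by symmetry. *)
Let left_right_comm k l psi : left_op k (right_op l psi) = right_op l (left_op k psi).
Proof.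
apply/funext => w; rewrite /left_op /right_op.
case: w => [|x w] /=; first by rewrite /head_contract /= A_sym; ring.
case/lastP: w => [|w y] /=; first by rewrite /head_contract /=; ring.
rewrite (_ : [:: k, x & rcons w y] = rcons [:: k, x & w] y)//.
by rewrite (_ : x :: rcons w y = rcons (x :: w) y)// !head_contract_rcons /=; ring.
Qed.

Let right_ops_left_op k v psi :
  left_op k (right_ops psi v) = right_ops (left_op k psi) v.
Proof. by elim: v psi => //= l v IH psi; rewrite IH left_right_comm. Qed.

(** At the empty word the last right operator agrees with the left one of the same index, which then
    commutes to the front; repeating this reverses [v]. *)
Let right_ops_left_ops psi v : right_ops psi v [::] = left_ops psi (rev v) [::].
Proof.
elim/last_ind: v psi => //= v k IH psi.
rewrite -cats1 foldl_cat /= cats1 rev_rcons /= -IH -right_ops_left_op.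
by rewrite /right_op /left_op.
Qed.

Lemma mixed_moment u v :
  right_ops (left_ops dlt u) v [::] = free_moment A (u ++ rev v).
Proof. by rewrite right_ops_left_ops -foldl_cat left_moment. Qed.

End FockFunctionals.

Lemma conjC_real_complex (R : realType) (r : R) : Num.conj r%:C = r%:C.
Proof. by apply/conj_Creal/complex_realP; exists r. Qed.

Section FockMoments.
Variables (R : realType) (H : realHilbert R) (F : fockSpace H).
Variables (I : eqType) (e : I -> H) (is_left : I -> bool) (c a : I -> F -> F).
Hypothesis c_left : forall k, is_left k -> is_left_creation (e k) (c k).
Hypothesis c_right : forall k, ~~ is_left k -> is_right_creation (e k) (c k).
Hypothesis ca_adjoint : forall k, is_adjoint (c k) (a k).
Local Notation A := (fun k l => hdot H (e k) (e l)).
Local Notation dot := (hdot F).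

Lemma real_hdotC (x y : H) : hdot H x y = hdot H y x.
Proof. by rewrite hermC /= expr0 mul1r. Qed.

Let hdot_eq0C (u v : F) : dot u v = 0 -> dot v u = 0.
Proof.
by move=> uv; have := hermC dot v u; rewrite /= uv rmorph0 mulr0.
Qed.

Let hdotPr x (u v y : F) : dot y (x *: u + v) = Num.conj x * dot y u + dot y v.
Proof. exact: linearPr. Qed.

Let hdotPl x (u v y : F) : dot (x *: u + v) y = x * dot u y + dot v y.
Proof. exact: linearPl. Qed.

Let hdotZr x (u y : F) : dot y (x *: u) = Num.conj x * dot y u.
Proof. exact: linearZr_LR. Qed.

Let hdot0r (y : F) : dot y 0 = 0.
Proof. exact: linear0r. Qed.

Let hdot_nondegenerate (u v : F) : (forall x, dot x u = dot x v) -> u = v.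
Proof.
move=> uv; apply/eqP; rewrite -subr_eq0 -normr_eq0 -sqrf_eq0 -hdot_norm.
by rewrite linearBr /= uv subrr.
Qed.

(** By density some combination [x] of tensors is closer to [v] than |v|, whereas orthogonality
    gives |v - x|^2 = |v|^2 + |x|^2. *)
Let orthogonal_tensors (v : F) : (forall xs, dot (tensor F xs) v = 0) -> v = 0.
Proof.
move=> ov; apply/eqP/negP => /negP v0.
have nv : 0 < `|v| by rewrite normr_gt0.
have [] := @tensor_dense _ _ F (ball v `|v|).
- by exists v; exact: ballxx.
- exact: ball_open.
move=> x [vx [s xE]].
have xv : dot x v = 0.
  rewrite xE linear_sumlz /= big1_seq// => p _.
  by rewrite linearZl_LR /= ov mulr0.
have : `|v| ^+ 2 <= `|v - x| ^+ 2.
  have -> : `|v - x| ^+ 2 = `|v| ^+ 2 + `|x| ^+ 2.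
    rewrite -!hdot_norm; transitivity (dot v (v - x) - dot x (v - x)).
      exact: linearBl.
    have -> : dot v (v - x) = dot v v - dot v x by exact: linearBr.
    have -> : dot x (v - x) = dot x v - dot x x by exact: linearBr.
    by rewrite xv (hdot_eq0C xv) subr0 sub0r opprK.
  by rewrite lerDl exprn_ge0.
rewrite ler_sqr ?nnegrE// => vx'.
by move: vx; rewrite -ball_normE /= => /(le_lt_trans vx'); rewrite ltxx.
Qed.

Let tensor_eq (u v : F) : (forall xs, dot (tensor F xs) u = dot (tensor F xs) v) ->
  u = v.
Proof.
move=> uv; apply/eqP; rewrite -subr_eq0; apply/eqP/orthogonal_tensors => xs.
by rewrite linearBr /= uv subrr.
Qed.

Let c_linear k : linear (c k).
Proof.
by have [/c_left[]|/c_right[]] := boolP (is_left k).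
Qed.

(** The operators [a k] are known only as adjoints, so their linearity and their values on tensors
    are read off from inner products. *)
Let a_linear k : linear (a k).
Proof.
move=> x u v; apply: hdot_nondegenerate => y.
by rewrite hdotPr -!ca_adjoint hdotPr.
Qed.

Let a_nil k : a k (tensor F [::]) = 0.
Proof.
apply: tensor_eq => xs; rewrite -ca_adjoint hdot0r.
have [/c_left[_ _ ->]|/c_right[_ _ ->]] := boolP (is_left k).
  by rewrite tensor_dot.
by rewrite tensor_dot size_rcons.
Qed.

Let a_cons k x xs : is_left k ->
  a k (tensor F (x :: xs)) = (hdot H x (e k))%:C *: tensor F xs.
Proof.
move=> lk; apply: tensor_eq => ys; have [_ _ cE] := c_left lk.
rewrite -ca_adjoint cE hdotZr !tensor_dot /= eqSS.
case: ifP => _; last by rewrite mulr0.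
by rewrite big_cons /= (real_hdotC (e k)) rmorphM conjC_real_complex.
Qed.

Let a_rcons k x xs : ~~ is_left k ->
  a k (tensor F (rcons xs x)) = (hdot H x (e k))%:C *: tensor F xs.
Proof.
move=> lk; apply: tensor_eq => ys; have [_ _ cE] := c_right lk.
rewrite -ca_adjoint cE hdotZr !tensor_dot /= !size_rcons eqSS.
case: eqP => [yx|_]; last by rewrite mulr0.
rewrite zip_rcons// big_rcons /= (real_hdotC (e k)) rmorphM conjC_real_complex.
by rewrite mulrC.
Qed.

Definition mixed_ops (B : I -> I -> R) (w : seq I) : seq I -> R :=
  foldl (fun psi k => if is_left k then left_op B k psi else right_op B k psi)
    (@vacuum_functional R I) w.

Let op k v := c k v + a k v.

Let op_linear k : linear (op k).
Proof.
move=> x u v; rewrite /op c_linear a_linear scalerDr.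
by rewrite addrACA.
Qed.

Let ops_linear w : linear (fun v => foldr op v w).
Proof. by elim: w => //= k w IH x u v; rewrite IH op_linear. Qed.

(** The last letter of [w] is the innermost operator. Applying it to the tensor amounts to applying
    the transposed operator to the functional of the remaining word, which is why [xs] is kept
    general. *)
Lemma fock_moment w xs :
  dot (foldr op (tensor F (map e xs)) w) (vacuum F) = (mixed_ops A w xs)%:C.
Proof.
elim/last_ind: w xs => [|w k IH] xs.
  rewrite /= tensor_dot /mixed_ops /= size_map /vacuum_functional.
  by case: xs => [|x xs] //=; rewrite big_nil.
have sem : forall ys zs (r : R), op k (tensor F (map e xs)) =
    tensor F (map e ys) + r%:C *: tensor F (map e zs) ->
    dot (foldr op (tensor F (map e xs)) (rcons w k)) (vacuum F) =
    (mixed_ops A w ys + r * mixed_ops A w zs)%:C.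
  move=> ys zs r E; rewrite foldr_rcons E addrC ops_linear hdotPl !IH.
  by rewrite addrC rmorphD rmorphM.
have sem0 : forall ys, op k (tensor F (map e xs)) = tensor F (map e ys) ->
    dot (foldr op (tensor F (map e xs)) (rcons w k)) (vacuum F) =
    (mixed_ops A w ys)%:C.
  by move=> ys E; rewrite foldr_rcons E IH.
have -> : mixed_ops A (rcons w k) = if is_left k then left_op A k (mixed_ops A w)
    else right_op A k (mixed_ops A w) by rewrite /mixed_ops foldl_rcons.
have [lk|rk] := boolP (is_left k).
  have [_ _ cE] := c_left lk; rewrite /left_op.
  case: xs sem sem0 => [|x xs] sem sem0 /=.
    by rewrite (sem0 [:: k]) ?addr0// /op cE a_nil addr0.
  by rewrite (sem [:: k, x & xs] xs (hdot H (e x) (e k))) ?(real_hdotC (e k))// /op cE a_cons.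
have [_ _ cE] := c_right rk; rewrite /right_op /head_contract.
case/lastP: xs sem sem0 => [|xs x] sem sem0 /=.
  by rewrite (sem0 [:: k]) ?addr0// /op cE a_nil addr0.
rewrite rev_rcons revK (real_hdotC (e k)).
by rewrite (sem (rcons (rcons xs x) k) xs (hdot H (e x) (e k)))// /op cE !map_rcons a_rcons.
Qed.

End FockMoments.

(** * Joint moments of the central limit distribution *)

Section CentralLimitMoments.
Variables (R : realType) (A : cstarAlgType R) (phi : {scalar A}).
Variables (n m : nat) (S : 'I_(n + m) -> A).
Hypothesis S_clt : bifree_central_limit phi S.
Local Notation cov := (cov_mx phi S).

Let in_left (k : 'I_(n + m)) := (k < n)%N.

Lemma clt_data : exists (H : realHilbert R) (e : 'I_(n + m) -> H),
  (forall i j, phi (S i * S j) = (hdot H (e i) (e j))%:C) /\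
  (forall w, phi (\prod_(k <- w) S k) =
     (mixed_ops in_left (fun k l => hdot H (e k) (e l)) w [::])%:C).
Proof.
have [_ [H [e [F [c [a [eS cl cr ca mom]]]]]]] := S_clt.
exists H, e; split=> [i j|w]; first by rewrite eS.
rewrite mom -(fock_moment (is_left := in_left) (a := a) _ _ ca) => [//|k kn|k kn].
  have -> : k = lshift m (Ordinal kn) by apply/val_inj.
  exact: cl.
have kn' : (k - n < m)%N.
  by move: kn (ltn_ord k); rewrite /in_left; lia.
have -> : k = rshift n (Ordinal kn').
  by apply/val_inj => /=; move: kn; rewrite /in_left; lia.
exact: cr.
Qed.

Lemma clt_cov_real i j : phi (S i * S j) = (cov i j)%:C.
Proof. by have [H [e [E _]]] := clt_data; rewrite mxE E. Qed.

Lemma clt_cov_sym i j : cov i j = cov j i.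
Proof.
have [H [e [E _]]] := clt_data.
by apply: complexI; rewrite -!clt_cov_real !E real_hdotC.
Qed.

(** [cov] is the Gram matrix of the vectors [e], so its quadratic form is a squared norm. *)
Lemma clt_cov_positive : positive_mx cov.
Proof.
split; first by apply/matrixP => i j; rewrite mxE clt_cov_sym.
move=> v; have [H [e [E _]]] := clt_data.
have cE i j : cov i j = hdot H (e i) (e j).
  by apply: complexI; rewrite -clt_cov_real E.
suff -> : (v *m cov *m v^T) 0 0 =
    hdot H (\sum_i v 0 i *: e i) (\sum_i v 0 i *: e i).
  by rewrite hdot_norm exprn_ge0.
have H1 y : hdot H (\sum_i v 0 i *: e i) y = \sum_i v 0 i * hdot H (e i) y.
  rewrite linear_sumlz; apply: eq_bigr => i _; exact: linearZl_LR.
rewrite mxE H1; under eq_bigr => j _ do rewrite !mxE mulr_suml.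
rewrite exchange_big /=; apply: eq_bigr => i _.
rewrite real_hdotC H1 mulr_sumr; apply: eq_bigr => j _.
by rewrite clt_cov_sym cE; ring.
Qed.

Lemma clt_moments w : phi (\prod_(k <- w) S k) = (mixed_ops in_left cov w [::])%:C.
Proof.
have [H [e [E ->]]] := clt_data; congr ((mixed_ops _ _ _ _)%:C).
apply/funext => i; apply/funext => j.
by apply: complexI; rewrite -clt_cov_real E.
Qed.

Lemma clt_mixed_moment (u : seq 'I_n) (v : seq 'I_m) :
  phi ((\prod_(i <- u) S (lshift m i)) * (\prod_(j <- v) S (rshift n j))) =
  (free_moment cov (map (@lshift n m) u ++ rev (map (@rshift n m) v)))%:C.
Proof.
rewrite -mixed_moment; last exact: clt_cov_sym.
have -> : (\prod_(i <- u) S (lshift m i)) * (\prod_(j <- v) S (rshift n j)) =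
    \prod_(k <- map (@lshift n m) u ++ map (@rshift n m) v) S k.
  by rewrite big_cat !big_map.
rewrite clt_moments; congr _%:C; rewrite /mixed_ops foldl_cat.
have lE i : in_left (lshift m i) = true by exact: (ltn_ord i).
have rE j : in_left (rshift n j) = false.
  by apply: negbTE; rewrite -leqNgt leq_addr.
have L x (psi : seq 'I_(n + m) -> R) :
   foldl (fun psi k => if in_left k then left_op cov k psi else right_op cov k psi)
     psi (map (@lshift n m) x) =
   foldl (fun psi k => left_op cov k psi) psi (map (@lshift n m) x).
  by elim: x psi => //= i x IH psi; rewrite lE IH.
have Rr x (psi : seq 'I_(n + m) -> R) :
   foldl (fun psi k => if in_left k then left_op cov k psi else right_op cov k psi)
     psi (map (@rshift n m) x) =
   foldl (fun psi k => right_op cov k psi) psi (map (@rshift n m) x).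
  by elim: x psi => //= i x IH psi; rewrite rE IH.
by rewrite L Rr.
Qed.

End CentralLimitMoments.

Lemma clt_moments_determined (R : realType) (A B : cstarAlgType R)
    (phi : {scalar A}) (psi : {scalar B}) (n m : nat)
    (S : 'I_(n + m) -> A) (T : 'I_(n + m) -> B) :
  bifree_central_limit phi S -> bifree_central_limit psi T ->
  cov_mx psi T = cov_mx phi S ->
  forall w, psi (\prod_(k <- w) T k) = phi (\prod_(k <- w) S k).
Proof. by move=> cS cT E w; rewrite !clt_moments// E. Qed.

(** * Matrices *)

Section Cholesky.
Variable R : realType.

(** Elimination of the first row and column. A zero corner forces the first row to vanish by
    positivity; otherwise the Schur complement of the corner is again positive. *)
Lemma cholesky p (M : 'M[R]_p) : positive_mx M -> exists L : 'M[R]_p,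
  [/\ forall i j : 'I_p, (i < j)%N -> L i j = 0, forall i, 0 <= L i i &
      M = L *m L^T].
Proof.
elim: p M => [|p IH] M [MT M0].
  by exists 0; split=> [[]//|[]//|]; rewrite [LHS]flatmx0 [RHS]flatmx0.
pose a := M 0 0; pose b : 'rV[R]_p := @ursubmx R 1 p 1 p M.
pose C : 'M[R]_p := @drsubmx R 1 p 1 p M.
have ME : M = @block_mx R 1 p 1 p a%:M b b^T C.
  have <- : @ulsubmx R 1 p 1 p M = a%:M.
    by rewrite [LHS]mx11_scalar !mxE; congr (M _ _)%:M; apply/val_inj.
  have <- : @dlsubmx R 1 p 1 p M = b^T by rewrite /b trmx_ursub MT.
  exact: (esym (@submxK R 1 p 1 p M)).
have CT : C^T = C by rewrite /C trmx_drsub MT.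
have trm1 (x : 'M[R]_1) : x^T = x by rewrite [x]mx11_scalar tr_scalar_mx.
have qE t (w : 'rV[R]_p) :
    (@row_mx R 1 1 p t%:M w *m (@block_mx R 1 p 1 p a%:M b b^T C) *m
       (@row_mx R 1 1 p t%:M w)^T) 0 0 =
    t ^+ 2 * a + 2 * t * (b *m w^T) 0 0 + (w *m C *m w^T) 0 0.
  rewrite mul_row_block tr_row_mx mul_row_col tr_scalar_mx.
  rewrite -scalar_mxM mulmxDl -scalar_mxM mulmxDl !mul_mx_scalar !mul_scalar_mx.
  rewrite -scalemxAl.
  have -> : w *m b^T = b *m w^T.
    by rewrite -[RHS]trm1 trmx_mul trmxK.
  by rewrite !mxE eqxx mulr1n; ring.
have q t (w : 'rV[R]_p) :
    0 <= t ^+ 2 * a + 2 * t * (b *m w^T) 0 0 + (w *m C *m w^T) 0 0.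
  by rewrite -qE; have := M0 (@row_mx R 1 1 p t%:M w); rewrite {1}ME.
have a0 : 0 <= a.
  by have := q 1 0; rewrite trmx0 !mulmx0 [in X in X -> _]mxE; lra.
have [c [l [L' [c0 ca cl [LT LP LE]]]]] :
  exists (c : R) (l : 'cV[R]_p) (L' : 'M[R]_p),
    [/\ 0 <= c, c ^+ 2 = a, c *: l = b^T &
       [/\ forall i j : 'I_p, (i < j)%N -> L' i j = 0, forall i, 0 <= L' i i &
       C = l *m l^T + L' *m L'^T]].
  have [az|an] := eqVneq a 0.
    have b0 : b = 0.
      apply/rowP => j; rewrite [RHS]mxE; apply/eqP/negP => /negP bj.
      pose w : 'rV[R]_p := delta_mx 0 j.
      (* This value of [t] makes the quadratic form equal to -1. *)
      have := q (- ((w *m C *m w^T) 0 0 + 1) / (2 * b 0 j)) w.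
      have -> : (b *m w^T) 0 0 = b 0 j.
        rewrite mxE (bigD1 j)//= !mxE !eqxx mulr1 big1 ?addr0// => k kj.
        by rewrite !mxE (negbTE kj) andbF mulr0.
      rewrite az mulr0 add0r; move: ((w *m C *m w^T) 0 0) (b 0 j) bj => x y y0.
      have -> : 2 * (- (x + 1) / (2 * y)) * y + x = -1 by field.
      by rewrite ler0N1.
    have [|L' [LT LP LE]] := IH C.
      split=> // w; have := q 0 w; rewrite expr0n mul0r mulr0 mul0r !add0r.
      exact.
    exists 0, 0, L'; split=> //; first by rewrite az expr0n.
      by rewrite scaler0 b0 trmx0.
    by split=> //; rewrite mul0mx add0r.
  have ap : 0 < a by rewrite lt_neqAle eq_sym an.
  pose c := Num.sqrt a; have cp : 0 < c by rewrite sqrtr_gt0.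
  have c2 : c ^+ 2 = a by rewrite sqr_sqrtr.
  pose l := c^-1 *: b^T.
  have [|L' [LT LP LE]] := IH (C - l *m l^T).
    split; first by rewrite linearB /= trmx_mul trmxK CT.
    (* The minimizer in [t], at which the form reduces to the Schur complement. *)
    move=> w; have := q (- (b *m w^T) 0 0 / a) w.
    have mB (X Y : 'M[R]_1) : (X - Y) 0 0 = X 0 0 - Y 0 0 by rewrite !mxE.
    rewrite mulmxBr mulmxBl mB.
    have -> : w *m (l *m l^T) *m w^T = ((b *m w^T) 0 0 ^+ 2 / a)%:M.
      have lw : l^T *m w^T = (c^-1 * (b *m w^T) 0 0)%:M.
        rewrite /l linearZ /= trmxK -scalemxAl [LHS]mx11_scalar.
        by congr (_%:M); rewrite [LHS]mxE.
      have -> : w *m (l *m l^T) *m w^T = (l^T *m w^T)^T *m (l^T *m w^T).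
        by rewrite trmx_mul !trmxK !mulmxA.
      rewrite lw tr_scalar_mx -scalar_mxM -c2; congr _%:M; field.
      by rewrite gt_eqF.
    have sE (x : R) : (x%:M : 'M[R]_1) 0 0 = x by rewrite mxE eqxx mulr1n.
    rewrite sE; move: ((b *m w^T) 0 0) ((w *m C *m w^T) 0 0) => x y.
    suff -> : (- x / a) ^+ 2 * a + 2 * (- x / a) * x + y = y - x ^+ 2 / a by [].
    by field; rewrite gt_eqF.
  exists c, l, L'; split=> //; first exact: ltW.
    by rewrite /l scalerA divff ?gt_eqF// scale1r.
  by split=> //; rewrite -LE addrC subrK.
pose B : 'M[R]_p.+1 := @block_mx R 1 p 1 p c%:M 0 l L'.
have lE (k : 'I_p) : lift ord0 k = rshift 1 k by apply/val_inj.
have oE : ord0 = lshift p (ord0 : 'I_1) by apply/val_inj.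
have Bdr i j : B (lift ord0 i) (lift ord0 j) = L' i j.
  by rewrite !lE; exact: block_mxEdr.
have Bur j : B ord0 (lift ord0 j) = 0.
  by rewrite lE oE; apply: (etrans (block_mxEur _ _ _ _ _ _)); rewrite mxE.
have Bul : B ord0 ord0 = c.
  by rewrite oE; apply: (etrans (block_mxEul _ _ _ _ _ _)); rewrite mxE mulr1n.
exists B; split.
- move=> i j; have [j' ->|->] := unliftP ord0 j; last by rewrite ltn0.
  have [i' ->|->] := unliftP ord0 i; last by rewrite Bur.
  by rewrite Bdr => ij; apply: LT.
- by move=> i; have [i' ->|->] := unliftP ord0 i; rewrite ?Bdr ?Bul.
have BT : B^T = @block_mx R 1 p 1 p c%:M l^T 0 L'^T.
  rewrite -[RHS](_ : @block_mx R 1 p 1 p (c%:M)^T l^T 0^T L'^T = _).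
    exact: (@tr_block_mx R 1 p 1 p c%:M 0 l L').
  by rewrite tr_scalar_mx trmx0.
have lT : c *: l^T = b by rewrite -linearZ /= cl trmxK.
rewrite ME BT /B; apply: esym.
apply: (etrans (@mulmx_block R 1 p 1 p 1 p c%:M 0 l L' c%:M l^T 0 L'^T)).
rewrite !mul0mx !mulmx0 !addr0 -scalar_mxM -expr2 ca mul_mx_scalar mul_scalar_mx.
by rewrite cl lT LE.
Qed.

End Cholesky.

(** * Operator norm of a self-adjoint matrix from traces of its powers *)

Section OperatorNorm.
Variable R : realType.
Notation C := R[i].

Let adj m n (M : 'M[C]_(m, n)) : 'M[C]_(n, m) := (map_mx Num.conj M)^T.

Let adjM m n k (M : 'M[C]_(m, n)) (N : 'M[C]_(n, k)) :
  adj (M *m N) = adj N *m adj M.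
Proof. by rewrite /adj map_mxM trmx_mul. Qed.

Let adjB m n (M N : 'M[C]_(m, n)) : adj (M - N) = adj M - adj N.
Proof. by rewrite /adj map_mxB linearB. Qed.

Let adjZ m n (x : R) (M : 'M[C]_(m, n)) : adj (x%:C *: M) = x%:C *: adj M.
Proof.
by rewrite /adj map_mxZ linearZ; congr (_ *: _); exact: conjC_real_complex.
Qed.

Let adjK m n (M : 'M[C]_(m, n)) : adj (adj M) = M.
Proof. by apply/matrixP => i j; rewrite !mxE conjCK. Qed.

(** The squared Hilbert-Schmidt norm, which on a column is the squared Euclidean norm. *)
Let hs m n (M : 'M[C]_(m, n)) : C := \tr (adj M *m M).

Let hs_ge0 m n (M : 'M[C]_(m, n)) : 0 <= hs M.
Proof.
apply: sumr_ge0 => i _; rewrite mxE; apply: sumr_ge0 => j _.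
by rewrite !mxE mulrC mul_conjC_ge0.
Qed.

Let hs_vnorm d (v : 'cV[C]_d) : (vnorm v ^+ 2)%:C = hs v.
Proof.
rewrite /vnorm sqr_sqrtr; last first.
  by apply: sumr_ge0 => i _; rewrite addr_ge0// sqr_ge0.
rewrite rmorph_sum /hs /mxtrace big_ord1 mxE; apply: eq_bigr => i _.
by rewrite [LHS]add_Re2_Im2 normCKC !mxE.
Qed.

Let vnorm_le d (v : 'cV[C]_d) (r : R) : 0 <= r ->
  (vnorm v <= r) = (hs v <= (r ^+ 2)%:C).
Proof.
by move=> r0; rewrite -hs_vnorm lecR ler_sqr ?nnegrE ?sqrtr_ge0.
Qed.

(** Expand the nonnegative quantity |K - (K v) v*|^2 = |K|^2 - 2 |K v|^2 + |v|^2 |K v|^2. *)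
Let hs_mul_le d (K : 'M[C]_d) (v : 'cV[C]_d) : hs v <= 1 -> hs (K *m v) <= hs K.
Proof.
move=> v1; set u := K *m v.
have := hs_ge0 (K - u *m adj v).
rewrite /hs adjB mulmxBl !mulmxBr !linearB /= adjM adjK -/(hs K).
have -> : \tr (adj K *m (u *m adj v)) = hs u.
  by rewrite mulmxA mxtrace_mulC mulmxA -adjM.
have -> : \tr (v *m adj u *m K) = hs u.
  by rewrite -mulmxA mxtrace_mulC -mulmxA.
have -> : \tr (v *m adj u *m (u *m adj v)) = hs v * hs u.
  have vv x : v *m (x%:M : 'M[C]_1) = x *: v by exact: mul_mx_scalar.
  rewrite -mulmxA mxtrace_mulC -!mulmxA [adj v *m v]mx11_scalar vv.
  rewrite -scalemxAr -scalemxAr mxtraceZ -/u.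
  by rewrite /hs /mxtrace !big_ord1.
rewrite /= => H.
have := hs_ge0 u; move: H; rewrite -/(hs u); move: (hs u) (hs v) (hs K) v1 => x y z y1 H x0.
have : y * x <= x by rewrite ler_piMl.
rewrite -subr_ge0 => H2.
rewrite -subr_ge0.
have -> : z - x = (z - x + (- x - - (y * x))) + (x - y * x) by ring.
exact: addr_ge0.
Qed.

(** Expanding |K^2 v - s^2 v|^2 >= 0 takes the place of the Cauchy-Schwarz inequality for |K v|^2 =
    <K^2 v, v>. *)
Let hs_mul_sqrt d (K : 'M[C]_d) (v : 'cV[C]_d) (s : R) : 0 < s -> adj K = K ->
  hs v <= 1 -> hs (K *m (K *m v)) <= (s ^+ 4)%:C -> hs (K *m v) <= (s ^+ 2)%:C.
Proof.
move=> s0 Ka v1 H; set u := K *m v in H *.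
have := hs_ge0 (K *m u - (s ^+ 2)%:C *: v).
rewrite {1}/hs adjB mulmxBl !mulmxBr !linearB /= adjM adjZ Ka.
rewrite -!scalemxAl -!scalemxAr !linearZ /=.
have -> : \tr (adj u *m K *m v) = hs u by rewrite -mulmxA.
have -> : \tr (adj v *m (K *m u)) = hs u by rewrite mulmxA -{1}Ka -adjM.
have -> : \tr (adj u *m K *m (K *m u)) = hs (K *m u) by rewrite /hs adjM Ka.
rewrite -/(hs v) => H1.
have s2 : 0 < (s ^+ 2)%:C :> C by rewrite ltcR exprn_gt0.
have s4 : (s ^+ 4)%:C = (s ^+ 2)%:C * (s ^+ 2)%:C :> C.
  by rewrite -rmorphM /= -exprD.
move: H1 H v1 s2; rewrite s4 /GRing.scale /=.
move: (hs (K *m u)) (hs u) (hs v) ((s ^+ 2)%:C) => k x y t H1 H y1 t0.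
rewrite -(ler_pM2l t0) -subr_ge0 -(pmulrn_lge0 _ (_ : 0 < 2)%N)//.
have -> : (t * t - t * x) *+ 2 =
  (k + t * - x + (t * - x + t * (t * - - y))) + (t * t - k) + t * t * (1 - y).
  by rewrite -mulr_natl; ring.
apply: addr_ge0; first by rewrite addr_ge0// subr_ge0.
by rewrite mulr_ge0 ?subr_ge0// mulr_ge0 ?ltW.
Qed.

(* ||H v|| is controlled by ||H^(2^J) v|| through repeated use of
   ||K v||^2 <= ||K^2 v|| ||v||, and the last term by the Hilbert-Schmidt norm. *)
Lemma opnorm_le_trace d (M : 'M[C]_d) (r : R) J : 0 < r -> M \is hermsymmx ->
  \tr (M ^+ (2 ^ J.+1)) <= (r ^+ (2 ^ J.+1))%:C -> opnorm M <= r.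
Proof.
move=> r0 /sesquiP; rewrite expr0 scale1r => Mh H.
have Ma : adj M = M by rewrite [RHS]Mh /adj map_trmx.
have Mk k : adj (M ^+ k) = M ^+ k.
  elim: k => [|k IH]; first by rewrite expr0 /adj map_mx1 trmx1.
  by rewrite exprSr -[LHS]/(adj (M ^+ k *m M)) adjM IH Ma -exprSr exprS.
apply: ge_sup.
  by exists (vnorm (M *m 0)), 0 => //=; rewrite vnorm_le// /hs mulmx0 mxtrace0 lecR exprn_ge0.
move=> _ [v /= v1 <-]; rewrite vnorm_le ?(ltW r0)//.
move: v1; rewrite vnorm_le// expr1n => v1.
suff S k : (k <= J)%N -> hs (M ^+ (2 ^ (J - k)) *m v) <= (r ^+ (2 * 2 ^ (J - k)))%:C.
  by have := S J (leqnn J); rewrite subnn expn0 muln1 expr1.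
elim: k => [_|k IH kJ].
  rewrite subn0 -expnS; apply: le_trans (hs_mul_le _ v1) _; apply: le_trans H.
  by rewrite /hs Mk -[_ *m _]/(_ * _) -exprD addnn -mul2n -expnS.
rewrite mulnC exprM; apply: hs_mul_sqrt => //; first by rewrite exprn_gt0.
have := IH (ltnW kJ); have -> : (J - k = (J - k.+1).+1)%N by lia.
rewrite expnS mul2n -addnn exprD -[_ * _]/(_ *m _) -mulmxA => /le_trans; apply.
by rewrite lecR -exprM le_eqVlt; apply/orP; left; apply/eqP; congr (_ ^+ _); lia.
Qed.

End OperatorNorm.

(** * Coordinates of self-adjoint matrices and their order *)

Lemma index_allpairs (S T : eqType) (s : seq S) (t : seq T) x y :
  x \in s -> y \in t ->
  index (x, y) [seq (x', y') | x' <- s, y' <- t] = (index x s * size t + index y t)%N.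
Proof.
move=> + yt; elim: s => //= x0 s IH; rewrite index_cat.
have inj0 z : injective (pair z : T -> S * T) by move=> ? ? [].
rewrite inE eq_sym; have [->|nx] /= := eqVneq x0 x.
  by rewrite mem_map// yt (index_map (inj0 x)) mul0n add0n.
move=> xs; rewrite ifN; last first.
  by apply/mapP => -[z _ [xE _]]; rewrite xE eqxx in nx.
by rewrite size_map IH// mulSn addnA.
Qed.

(** Triangularity refers to the order of the coordinates, so their lexicographic numbering has to be
    explicit. *)
Lemma val_mxvec_index m n (i : 'I_m) (j : 'I_n) :
  mxvec_index i j = (i * n + j)%N :> nat.
Proof.
have rankE (T : finType) (x : T) : enum_rank x = index x (enum T) :> nat.
  rewrite -{2}(nth_enum_rank x x) index_uniq ?enum_uniq// -cardE.
  exact: ltn_ord.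
rewrite /mxvec_index /= rankE.
have -> : enum {: 'I_m * 'I_n} = [seq (x, y) | x <- enum 'I_m, y <- enum 'I_n].
  by rewrite enumT unlock.
by rewrite index_allpairs ?mem_enum// !index_enum_ord -cardE card_ord.
Qed.

Section SelfAdjointCoordinates.
Variable R : realType.
Notation C := R[i].

(* [sa_mx] with coordinates in any module, so that it also applies to polynomial
   variables and to their partial derivatives. *)
Definition sa_entry (V : lmodType C) d (f : 'I_d -> 'I_d -> V) (i j : 'I_d) : V :=
  if i == j then f i i
  else if (i < j)%N then ((Num.sqrt 2)^-1)%:C *: (f i j + 'i%C *: f j i)
  else ((Num.sqrt 2)^-1)%:C *: (f j i - 'i%C *: f i j).

Lemma sa_mx_entry d (x : 'I_d -> 'I_d -> R) i j :
  sa_mx x i j = sa_entry (V := C^o) (fun a b => (x a b)%:C) i j.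
Proof.
rewrite mxE /sa_entry /GRing.scale /=; have [//|_ /=] := eqVneq i j.
by case: ifP => _; apply/eqP; rewrite eq_complex /=; apply/andP; split; apply/eqP; ring.
Qed.

Lemma sa_entry_linear (V W : lmodType C) d (g : V -> W)
    (f : 'I_d -> 'I_d -> V) i j : linear g ->
  g (sa_entry f i j) = sa_entry (fun a b => g (f a b)) i j.
Proof.
move=> gl.
have g0 : g 0 = 0.
  by apply: (addrI (1 *: g 0)); rewrite -gl !scale1r !addr0.
have gZ c v : g (c *: v) = c *: g v by rewrite -[c *: v]addr0 gl g0 addr0.
have gD u v : g (u + v) = g u + g v by rewrite -[u]scale1r gl !scale1r.
have gB u v : g (u - v) = g u - g v by rewrite gD -scaleN1r gZ scaleN1r.
rewrite /sa_entry; have [//|_ /=] := eqVneq i j.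
by case: ifP => _; rewrite gZ ?gB ?gD gZ.
Qed.

Lemma sa_entryD (V : lmodType C) d (f g : 'I_d -> 'I_d -> V) i j :
  sa_entry (fun a b => f a b + g a b) i j = sa_entry f i j + sa_entry g i j.
Proof.
by rewrite /sa_entry; have [//|_ /=] := eqVneq i j; case: ifP => _;
  rewrite -scalerDr; congr (_ *: _); rewrite scalerDr ?opprD addrACA.
Qed.

Lemma sa_entryZ (V : lmodType C) d (f : 'I_d -> 'I_d -> V) (c : C) i j :
  sa_entry (fun a b => c *: f a b) i j = c *: sa_entry f i j.
Proof.
have Zc (x : C) (v : V) : x *: (c *: v) = c *: (x *: v) by rewrite !scalerA mulrC.
rewrite /sa_entry; have [//|_ /=] := eqVneq i j.
by case: ifP => _; rewrite (Zc 'i%C) -1?scalerBr -1?scalerDr Zc.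
Qed.

(** The completeness relation of the orthonormal basis: the products of the entries (i, j) and (x,
    y), summed over the basis matrices, give the covariance of the entries of a standard Gaussian
    self-adjoint matrix. *)
Lemma sa_entry_contract (P : comAlgType C) d (i j x y : 'I_d) :
  sa_entry (fun a b => sa_entry (fun a' b' => ((a == a') && (b == b'))%:R : P) x y) i j
  = ((i == y) && (j == x))%:R.
Proof.
pose q : C := ((Num.sqrt 2)^-1)%:C.
have q2 : q * q = 2^-1.
  rewrite /q -rmorphM /= -invfM -expr2 sqr_sqrtr//.
  by rewrite fmorphV /= rmorph_nat.
have i2 : 'i%C * 'i%C = -1 :> C by rewrite -expr2 sqr_i.
have qq (u : P) : q *: (q *: u) = 2^-1 *: u by rewrite scalerA q2.
have ii (u : P) : 'i%C *: ('i%C *: u) = - u by rewrite scalerA i2 scaleN1r.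
have iq (u : P) : 'i%C *: (q *: u) = q *: ('i%C *: u) by rewrite !scalerA mulrC.
have half (u : P) : 2^-1 *: (u + u) = u.
  by rewrite -mulr2n -[u *+ 2]scaler_nat scalerA mulVf ?scale1r// pnatr_eq0.
rewrite /sa_entry -/q.
have [<-|ij] := eqVneq i j; have [<-|xy] := eqVneq x y => /=.
- by [].
- have -> : (i == x) && (i == y) = false.
    by apply/negP => /andP[/eqP ix /eqP iy]; rewrite -ix -iy eqxx in xy.
  have -> : (i == y) && (i == x) = false.
    by apply/negP => /andP[/eqP iy /eqP ix]; rewrite -ix -iy eqxx in xy.
  by case: ifP => _; rewrite !(mulr0n, scaler0, addr0, oppr0).
- have -> : (i == x) && (j == x) = false.
    by apply/negP => /andP[/eqP ix /eqP jx]; rewrite ix jx eqxx in ij.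
  have -> : (j == x) && (i == x) = false.
    by apply/negP => /andP[/eqP jx /eqP ix]; rewrite ix jx eqxx in ij.
  by case: ifP => _; rewrite !(mulr0n, scaler0, addr0, oppr0).
rewrite [(j == x) && (i == y)]andbC [(j == y) && (i == x)]andbC.
set al : P := ((i == x) && (j == y))%:R.
set be : P := ((i == y) && (j == x))%:R.
have be0 : ((i < j) = (x < y))%N -> be = 0.
  rewrite /be => ltE; case: andP => // -[/eqP iy /eqP jx]; exfalso.
  by move: ltE ij; rewrite iy jx neq_ltn; case: ltngtP.
case: ifP => ltij; case: ifP => ltxy.
- by rewrite be0 ?ltij ?ltxy// !(scaler0, addr0, add0r) iq ii -scalerDr subrr !scaler0.
- rewrite iq -scalerDr qq ['i%C *: (al - _)]scalerBr ii opprK.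
  rewrite (_ : be - 'i%C *: al + ('i%C *: al + be) = be + be) ?half//.
  by rewrite addrA subrK.
- rewrite iq -scalerBr qq ['i%C *: (al + _)]scalerDr ii.
  rewrite (_ : be + 'i%C *: al - ('i%C *: al - be) = be + be) ?half//.
  by rewrite opprB addrA -[be + _ + be]addrA [_ *: al + be]addrC !addrA addrK.
- rewrite be0 ?ltij ?ltxy// !(scaler0, addr0, add0r, subr0, sub0r).
  by rewrite !scalerN opprK iq ii -scalerDr subrr !scaler0.
Qed.

Lemma sa_mx_hermitian d (x : 'I_d -> 'I_d -> R) : sa_mx x \is hermsymmx.
Proof.
apply/sesquiP; rewrite expr0 scale1r; apply/matrixP => i j.
transitivity (conjc (sa_mx x j i)); last by rewrite [RHS]mxE [in RHS]mxE.
rewrite !mxE (eq_sym j i); case: (ltngtP i j) => ij.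
- have /negbTE -> : i != j by apply: contraTneq ij => ->; rewrite ltnn.
  by rewrite /= opprK.
- by have /negbTE -> : i != j by apply: contraTneq ij => ->; rewrite ltnn.
- by move/val_inj: ij => ->; rewrite eqxx conjc_real.
Qed.

Lemma sa_mx_trace d (x : 'I_d -> 'I_d -> R) :
  \tr (sa_mx x * sa_mx x) = (\sum_i \sum_j x i j ^+ 2)%:C.
Proof.
have E i j : sa_mx x i j * sa_mx x j i = ((x i j ^+ 2 + x j i ^+ 2) / 2)%:C.
  have H : (Num.sqrt 2)^-1 * (Num.sqrt 2)^-1 = 2^-1 :> R.
    by rewrite -invfM -expr2 sqr_sqrtr.
  rewrite !mxE (eq_sym j i); case: (ltngtP i j) => ij.
  - have /negbTE -> : i != j by apply: contraTneq ij => ->; rewrite ltnn.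
    apply/eqP; rewrite eq_complex /=.
    apply/andP; split; apply/eqP; last by ring.
    transitivity ((x i j ^+ 2 + x j i ^+ 2) * ((Num.sqrt 2)^-1 * (Num.sqrt 2)^-1)).
      by ring.
    by rewrite H.
  - have /negbTE -> : i != j by apply: contraTneq ij => ->; rewrite ltnn.
    apply/eqP; rewrite eq_complex /=.
    apply/andP; split; apply/eqP; last by ring.
    transitivity ((x i j ^+ 2 + x j i ^+ 2) * ((Num.sqrt 2)^-1 * (Num.sqrt 2)^-1)).
      by ring.
    by rewrite H.
  - move/val_inj: ij => ->; rewrite eqxx -rmorphM /=; congr _%:C; by field.
transitivity (\sum_i \sum_j ((x i j ^+ 2 + x j i ^+ 2) / 2)%:C).
  by apply: eq_bigr => i _; rewrite mxE; apply: eq_bigr => j _; exact: E.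
under eq_bigr => i _ do rewrite -rmorph_sum.
rewrite -rmorph_sum /=; congr _%:C.
under eq_bigr => i _ do rewrite -mulr_suml big_split /=.
rewrite -mulr_suml big_split /= [X in _ + X]exchange_big /=.
by field.
Qed.

End SelfAdjointCoordinates.

(** * Correlated Gaussian matrices *)

Section GaussianMatrices.
Variables (R : realType) (p : nat) (L : 'M[R]_p).
Notation C := R[i].

Section FixedDimension.
Variable d : nat.
Notation N := (p * (d * d))%N.
Notation P := (mpoly N C).
Notation scaled := ((Num.sqrt d%:R)^-1 *: L).

Definition coord (l : 'I_p) (a b : 'I_d) : 'I_N :=
  mxvec_index l (mxvec_index a b).

Lemma coord_inj l a b l' a' b' :
  (coord l a b == coord l' a' b') = [&& l == l', a == a' & b == b'].
Proof.
have inj m n (i i' : 'I_m) (j j' : 'I_n) :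
    (mxvec_index i j == mxvec_index i' j') = (i == i') && (j == j').
  by rewrite /mxvec_index (inj_eq (@cast_ord_inj _ _ _)) (inj_eq enum_rank_inj).
by rewrite /coord !inj.
Qed.

Let var l a b : P := mpolyX C (mnm1 (coord l a b)).

Definition gauss_mx (k : 'I_p) : 'M[P]_d :=
  \matrix_(i, j) \sum_l (scaled k l)%:C *: sa_entry (var l) i j.

(** The partial derivatives are combined with the same coefficients as the variables in [gauss_mx],
    so integration by parts in each variable becomes integration by parts in each entry. *)
Let der k i j (f : P) : P :=
  \sum_l (scaled k l)%:C *: sa_entry (fun a b => mderiv (coord l a b) f) i j.

Let derD k i j f g : der k i j (f + g) = der k i j f + der k i j g.
Proof.
rewrite /der -big_split /=; apply: eq_bigr => l _; rewrite -scalerDr -sa_entryD.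
congr (_ *: _); congr sa_entry; apply/funext => a; apply/funext => b.
by rewrite mderivD.
Qed.

Let derM k i j f g : der k i j (f * g) = der k i j f * g + f * der k i j g.
Proof.
rewrite /der mulr_suml mulr_sumr -big_split /=; apply: eq_bigr => l _.
rewrite -scalerAl -scalerAr -scalerDr; congr (_ *: _).
rewrite (sa_entry_linear (g := fun x : P => x * g)); last first.
  by move=> x u v; rewrite mulrDl scalerAl.
rewrite (sa_entry_linear (g := fun x : P => f * x)); last first.
  by move=> x u v; rewrite mulrDr scalerAr.
rewrite -sa_entryD; congr sa_entry; apply/funext => a; apply/funext => b.
by rewrite mderivM.
Qed.

Let der_var (i j : 'I_N) : mderiv i (mpolyX C (mnm1 j)) = (j == i)%:R.
Proof.
rewrite mderivX mnm1E; have [->|_] := eqVneq j i; last by rewrite scale0r.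
rewrite scale1r (_ : mnm_sub _ _ = @mnm0 N) ?mpolyX0//.
by apply/mnmP => k; rewrite mnmBE mnm0E subnn.
Qed.

Let der_sa_entry m a b l x y : mderiv (coord m a b) (sa_entry (var l) x y) =
  sa_entry (fun a' b' => ((l == m) && ((a == a') && (b == b')))%:R) x y.
Proof.
rewrite (sa_entry_linear (g := mderiv (coord m a b))); last exact: linearP.
congr sa_entry; apply/funext => a'; apply/funext => b'.
by rewrite der_var coord_inj [a' == a]eq_sym [b' == b]eq_sym.
Qed.

Let der_gauss k i j l x y : der k i j (gauss_mx l x y) =
  (((L *m L^T) k l / d%:R)%:C) *: ((i == y) && (j == x))%:R.
Proof.
transitivity (\sum_m (scaled k m)%:C *: ((scaled l m)%:C *:
    (((i == y) && (j == x))%:R : P))).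
  rewrite /der; apply: eq_bigr => m _; congr (_ *: _).
  rewrite -(sa_entry_contract P i j x y) -sa_entryZ; congr sa_entry.
  apply/funext => a; apply/funext => b.
  rewrite mxE raddf_sum (bigD1 m)//= big1 ?addr0 => [|m' m'm].
    by rewrite mderivZ der_sa_entry eqxx.
  rewrite mderivZ der_sa_entry (negbTE m'm) /=.
  by rewrite /sa_entry !(scaler0, addr0, oppr0) !if_same scaler0.
under eq_bigr do rewrite scalerA.
rewrite -scaler_suml; congr (_ *: _).
rewrite mxE mulr_suml rmorph_sum; apply: eq_bigr => m _.
rewrite -rmorphM /= !mxE; congr _%:C.
have -> : (d%:R : R)^-1 = (Num.sqrt d%:R)^-1 * (Num.sqrt d%:R)^-1.
  by rewrite -invfM -expr2 sqr_sqrtr.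
by ring.
Qed.

Let gauss_stein k i j f :
  mexpect (gauss_mx k i j * f) = mexpect (der k i j f).
Proof.
rewrite mxE mulr_suml /der !raddf_sum; apply: eq_bigr => l _ /=.
rewrite -scalerAl !linearZ /=; congr (_ * _).
rewrite (sa_entry_linear (g := fun x : P => x * f)); last first.
  by move=> x u v; rewrite mulrDl scalerAl.
rewrite (sa_entry_linear (W := C^o) (g := @mexpect R N)); last exact: linearP.
rewrite (sa_entry_linear (W := C^o) (g := @mexpect R N)); last exact: linearP.
congr sa_entry; apply/funext => a; apply/funext => b.
exact: mexpect_stein.
Qed.

Lemma gauss_schwinger_dyson k w ws :
  mexpect (trwords gauss_mx ((k :: w) :: ws)) =
  \sum_(s <- splits w) ((L *m L^T) k s.1.2 / d%:R)%:C *
     mexpect (trwords gauss_mx [:: s.1.1, s.2 & ws]) +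
  \sum_(q <- picks ws) \sum_(s <- splits q.1) ((L *m L^T) k s.1.2 / d%:R)%:C *
     mexpect (trwords gauss_mx ((w ++ s.2 ++ s.1.1) :: q.2)).
Proof. exact: (schwinger_dyson derD derM der_gauss gauss_stein). Qed.

End FixedDimension.

Let Re_scale (x : R) (z : C) : complex.Re (x%:C * z) = x * complex.Re z.
Proof. by case: z => a b /=; rewrite mul0r subr0. Qed.

Definition mean_traces (d : nat) (ws : seq (seq 'I_p)) : R :=
  complex.Re (mexpect (trwords (gauss_mx d) ws)) / d%:R ^+ size ws.

Lemma mean_traces0 d : mean_traces d [::] = 1.
Proof.
by rewrite /mean_traces /trwords big_nil mexpect1 expr0 divr1.
Qed.

Lemma mean_traces_nil d ws : (0 < d)%N ->
  mean_traces d ([::] :: ws) = mean_traces d ws.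
Proof.
move=> d0; rewrite /mean_traces /trwords big_cons /= exprS.
have -> : trword (gauss_mx d) [::] = (d%:R : C) *: 1.
  by rewrite /trword /mxword big_nil mxtrace1 scaler_nat.
rewrite -scalerAl mul1r linearZ /= -(rmorph_nat (real_complex R)).
rewrite Re_scale -mulf_div divff ?mul1r//.
by rewrite pnatr_eq0 -lt0n.
Qed.

(** The covariance supplies 1 / d. A split adds a trace, whose normalization cancels this factor; a
    merge loses one and leaves 1 / d^2. *)
Lemma mean_traces_cons d k w ws : (0 < d)%N ->
  mean_traces d ((k :: w) :: ws) =
  \sum_(s <- splits w) (L *m L^T) k s.1.2 * mean_traces d [:: s.1.1, s.2 & ws] +
  (d%:R ^+ 2)^-1 * \sum_(q <- picks ws) \sum_(s <- splits q.1)
     (L *m L^T) k s.1.2 * mean_traces d ((w ++ s.2 ++ s.1.1) :: q.2).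
Proof.
move=> d0; have dn0 : d%:R != 0 :> R by rewrite pnatr_eq0 -lt0n.
rewrite /mean_traces gauss_schwinger_dyson raddfD mulrDl; congr (_ + _).
  rewrite raddf_sum mulr_suml; apply: eq_bigr => s _.
  by rewrite /= Re_scale !exprS; field; rewrite dn0 expf_neq0.
rewrite raddf_sum mulr_suml mulr_sumr big_seq [RHS]big_seq.
apply: eq_bigr => q /(big_picks addn (fun=> 1%N)); rewrite !sum1_size /= => ->.
rewrite raddf_sum mulr_suml mulr_sumr; apply: eq_bigr => s _.
by rewrite /= Re_scale add1n !exprS; field; rewrite dn0 expf_neq0.
Qed.

End GaussianMatrices.

Lemma big_mxvec_index (S : Type) (idx : S) (op : Monoid.com_law idx) m n
    (f : 'I_(m * n) -> S) :
  \big[op/idx]_i f i = \big[op/idx]_i \big[op/idx]_j f (mxvec_index i j).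
Proof.
rewrite pair_bigA /= (reindex _ (curry_mxvec_bij m n)) /=.
by apply: eq_bigr => -[i j].
Qed.

(** * Linear mixing of the matrices, in coordinates *)

Section CoordinateChange.
Variables (R : realType) (p d : nat).
Notation C := R[i].
Notation N := (p * (d * d))%N.
Implicit Types (M L : 'M[R]_p) (t : N.-tuple R).

Definition mix M t : N.-tuple R :=
  [tuple (mxvec (M *m vec_mx (\row_i tnth t i))) 0 i | i < N].

Lemma tnth_mix M t k c :
  tnth (mix M t) (mxvec_index k c) = \sum_l M k l * tnth t (mxvec_index l c).
Proof.
rewrite tnth_mktuple mxvecE mxE; apply: eq_bigr => l _.
by rewrite [vec_mx _ _ _]mxE mxE.
Qed.

Lemma mix1 t : mix 1%:M t = t.
Proof.
apply: eq_from_tnth => i; case/mxvec_indexP: i => k c; rewrite tnth_mix.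
rewrite (bigD1 k)//= big1 ?addr0 => [|l lk]; rewrite mxE ?eqxx ?mul1r//.
by rewrite eq_sym (negbTE lk) mul0r.
Qed.

Lemma mixM M M' t : mix M (mix M' t) = mix (M *m M') t.
Proof.
apply: eq_from_tnth => i; case/mxvec_indexP: i => k c; rewrite !tnth_mix.
under eq_bigr do rewrite tnth_mix mulr_sumr.
rewrite exchange_big; apply: eq_bigr => l _; rewrite mxE mulr_suml.
by apply: eq_bigr => j _; rewrite mulrA.
Qed.

Lemma sa_entry_sum (V : lmodType C) (J : finType) (c : J -> C)
    (f : J -> 'I_d -> 'I_d -> V) i j :
  sa_entry (fun a b => \sum_l c l *: f l a b) i j = \sum_l c l *: sa_entry (f l) i j.
Proof.
rewrite /sa_entry; case: ifP => // _.
have Zc (x y : C) (v : V) : x *: (y *: v) = y *: (x *: v).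
  by rewrite !scalerA mulrC.
case: ifP => _; rewrite scaler_sumr -?sumrB -?big_split /= scaler_sumr;
  apply: eq_bigr => l _.
- by rewrite (Zc 'i%C) -scalerDr Zc.
- by rewrite (Zc 'i%C) -scalerBr Zc.
Qed.

Lemma sa_family_mix M t k :
  sa_family (mix M t) k = \sum_l (M k l)%:C *: sa_family t l.
Proof.
apply/matrixP => i j; rewrite summxE sa_mx_entry.
transitivity (sa_entry (V := C^o) (fun a b => \sum_l (M k l)%:C *:
    ((tnth t (mxvec_index l (mxvec_index a b)))%:C : C^o)) i j).
  congr sa_entry; apply/funext => a; apply/funext => b.
  by rewrite tnth_mix rmorph_sum; apply: eq_bigr => l _; rewrite rmorphM.
rewrite sa_entry_sum; apply: eq_bigr => l _.
by rewrite mxE -sa_mx_entry.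
Qed.

Lemma sqnorm_sa_family t :
  \sum_i tnth t i ^+ 2 = complex.Re (\sum_k \tr (sa_family t k * sa_family t k)).
Proof.
rewrite big_mxvec_index raddf_sum; apply: eq_bigr => k _.
by rewrite big_mxvec_index sa_mx_trace.
Qed.

Definition diag_coords L (i : 'I_N) : R := (mxvec (\matrix_(k, c) L k k)) 0 i.

(** A coordinate of the l-th matrix precedes every coordinate of the k-th one when l < k, so the
    strictly lower part of [L] involves earlier coordinates only. *)
Lemma mix_triangular L : (forall i j : 'I_p, (i < j)%N -> L i j = 0) ->
  triangular (diag_coords L) (mix L).
Proof.
move=> LT.
exists (fun i t => (mxvec ((\matrix_(k, l) (if (l < k)%N then L k l else 0)) *m
   vec_mx (\row_i tnth t i))) 0 i); split.
  move=> i t t' tt'; case/mxvec_indexP: i tt' => k c tt'; rewrite !mxvecE !mxE.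
  apply: eq_bigr => l _; rewrite !mxE; case: ifP => [lk|]; last by rewrite !mul0r.
  congr (_ * _); apply: tt'; rewrite !val_mxvec_index.
  apply: leq_trans (_ : l.+1 * (d * d) <= _)%N; first by rewrite mulSn addnC ltn_add2r.
  by rewrite (leq_trans (leq_mul lk (leqnn _)))// leq_addr.
move=> t i; case/mxvec_indexP: i => k c; rewrite tnth_mix /diag_coords !mxvecE !mxE.
rewrite (bigD1 k)//=; congr (_ + _).
rewrite [RHS](bigD1 k)//= mxE ltnn mul0r add0r.
apply: eq_bigr => l lk; rewrite !mxE; case: ltngtP => // kl.
  by rewrite LT// mul0r.
by move: lk; rewrite -val_eqE /= kl eqxx.
Qed.

Lemma diag_coords_prod L : \prod_i diag_coords L i = (\prod_k L k k) ^+ (d * d).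
Proof.
rewrite big_mxvec_index -prodrXl; apply: eq_bigr => k _.
under eq_bigr do rewrite /diag_coords mxvecE mxE.
by rewrite prodr_const card_ord.
Qed.

Lemma diag_coords_gt0 L : (forall k, 0 < L k k) -> forall i, 0 < diag_coords L i.
Proof. by move=> L0 i; case/mxvec_indexP: i => k c; rewrite /diag_coords mxvecE mxE. Qed.

Lemma meval_gauss_mx L t k :
  map_mx (meval (rval t)) (gauss_mx L d k) = sa_family (mix ((Num.sqrt d%:R)^-1 *: L) t) k.
Proof.
rewrite sa_family_mix; apply/matrixP => i j; rewrite !mxE summxE raddf_sum.
apply: eq_bigr => l _ /=; rewrite mevalZ [RHS]mxE; congr (_ * _).
rewrite sa_mx_entry (sa_entry_linear (W := C^o) (g := meval (rval t))); last first.
  by move=> x u v; rewrite mevalD mevalZ.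
by congr sa_entry; apply/funext => a; apply/funext => b; rewrite mevalXU.
Qed.

Lemma meval_gauss_trword L t w :
  meval (rval t) (trword (gauss_mx L d) w) =
  \tr (\prod_(k <- w) sa_family (mix ((Num.sqrt d%:R)^-1 *: L) t) k).
Proof.
rewrite /trword raddf_sum /mxtrace.
have -> : \prod_(k <- w) sa_family (mix ((Num.sqrt d%:R)^-1 *: L) t) k =
    map_mx (meval (rval t)) (mxword (gauss_mx L d) w).
  elim: w => [|k w IH]; rewrite /mxword ?big_nil ?big_cons ?map_mx1//.
  by rewrite map_mxM meval_gauss_mx -IH.
by apply: eq_bigr => i _; rewrite mxE.
Qed.

Lemma trace_word_rev (B : 'I_p -> 'M[C]_d) w : (forall k, B k \is hermsymmx) ->
  conjc (\tr (\prod_(k <- w) B k)) = \tr (\prod_(k <- rev w) B k).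
Proof.
move=> Bh.
have BE k : B k = (map_mx conjc (B k))^T.
  have /sesquiP := Bh k; rewrite expr0 scale1r => E.
  by rewrite [LHS]E map_trmx.
have E u : (map_mx conjc (\prod_(k <- u) B k))^T = \prod_(k <- rev u) B k.
  elim: u => [|k u IH]; first by rewrite !big_nil map_mx1 trmx1.
  rewrite big_cons rev_cons -cats1 big_cat big_seq1 /= -IH.
  by rewrite -[B k * _]/(B k *m _) map_mxM trmx_mul -BE.
rewrite -E mxtrace_tr /mxtrace rmorph_sum.
by apply: eq_bigr => i _; rewrite mxE.
Qed.

(** Recovering [t] from the matrices through [L'] expresses the exponent of the Gaussian weight by
    second moments, which microstates control. *)
Lemma sqnorm_mix L L' t : L' *m L = 1%:M -> (0 < d)%N ->
  let B := sa_family (mix ((Num.sqrt d%:R)^-1 *: L) t) in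
  \sum_i tnth t i ^+ 2 =
  d%:R * \sum_i \sum_j (L'^T *m L') i j * complex.Re (\tr (B i * B j)).
Proof.
move=> LL d0 B; rewrite sqnorm_sa_family.
have sd : Num.sqrt d%:R != 0 :> R by rewrite gt_eqF// sqrtr_gt0 ltr0n.
have E k : sa_family t k = \sum_i (Num.sqrt d%:R * L' k i)%:C *: B i.
  have {1}<- : mix (Num.sqrt d%:R *: L') (mix ((Num.sqrt d%:R)^-1 *: L) t) = t.
    by rewrite mixM -scalemxAl -scalemxAr scalerA divff// scale1r LL mix1.
  by rewrite sa_family_mix; apply: eq_bigr => i _; rewrite mxE.
have T k : \tr (sa_family t k * sa_family t k) = \sum_i \sum_j
    (d%:R * (L' k i * L' k j))%:C * \tr (B i * B j).
  rewrite E mulr_suml raddf_sum; apply: eq_bigr => i _.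
  rewrite mulr_sumr raddf_sum; apply: eq_bigr => j _ /=.
  rewrite -[_ * _]/(_ *m _) -scalemxAl -scalemxAr scalerA mxtraceZ -rmorphM /=.
  congr (_%:C * _); rewrite mulrACA -expr2 sqr_sqrtr//.
rewrite raddf_sum; under eq_bigr => k _.
  rewrite T raddf_sum; under eq_bigr => i _.
    rewrite raddf_sum; over.
  over.
rewrite exchange_big mulr_sumr; apply: eq_bigr => i _.
rewrite exchange_big mulr_sumr; apply: eq_bigr => j _.
rewrite mxE mulr_suml mulr_sumr; apply: eq_bigr => k _ /=.
by case: (\tr _) => x y /=; rewrite mxE; ring.
Qed.

End CoordinateChange.

(** * Entropy bounds *)

Section LimitSuperior.
Variable R : realType.
Implicit Types (u : nat -> \bar R) (c : \bar R).

Lemma limn_esup_le u c n0 :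
  (forall n, (n0 <= n)%N -> (u n <= c)%E) -> (limn_esup u <= c)%E.
Proof.
move=> H; apply: (@le_trans _ _ (ereal_sup (u @` [set n | (n0 <= n)%N]))).
  by apply: ereal_inf_lbound; exists [set n | (n0 <= n)%N] => //; exists n0.
by apply: ge_ereal_sup => _ [n /= /H ? <-].
Qed.

Lemma le_limn_esup u c :
  (forall n0, exists2 n, (n0 <= n)%N & (c <= u n)%E) -> (c <= limn_esup u)%E.
Proof.
move=> H; apply: le_ereal_inf_tmp => _ [V [n0 _ n0V] <-].
have [n n0n cn] := H n0; apply: le_trans cn _.
by apply: ereal_sup_ubound; exists n => //; apply: n0V.
Qed.

End LimitSuperior.

Section EntropyScaling.
Variables (R : realType) (p d : nat) (L : 'M[R]_p).
Hypothesis d_gt0 : (0 < d)%N.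
Hypothesis L_gt0 : forall k, 0 < L k k.
Notation scaled := ((Num.sqrt d%:R)^-1 *: L).

Let dR_gt0 : 0 < d%:R :> R. Proof. by rewrite ltr0n. Qed.

Let scaled_gt0 k : 0 < scaled k k.
Proof. by rewrite mxE mulr_gt0// invr_gt0 sqrtr_gt0. Qed.

(** The bound that both comparison lemmas yield for the constant exp(d^2 x) and the substitution by
    d^(-1/2) L. *)
Definition gauss_volume (x : R) : R := expR (d%:R ^+ 2 * x) *
  (Num.sqrt (2 * pi) ^+ (p * (d * d)) * \prod_i @diag_coords R p d scaled i).

Lemma gauss_volume_gt0 x : 0 < gauss_volume x.
Proof.
rewrite !mulr_gt0 ?expR_gt0//.
  by rewrite exprn_gt0// sqrtr_gt0 mulr_gt0// pi_gt0.
by apply: prodr_gt0 => i _; apply: diag_coords_gt0.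
Qed.

Lemma entropy_gauss_volume x :
  ((d%:R ^+ 2)^-1 * ln (gauss_volume x) + p%:R / 2 * ln d%:R =
   x + p%:R / 2 * ln (2 * pi) + ln (\prod_k L k k)).
Proof.
have pi2 : 0 < 2 * pi :> R by rewrite mulr_gt0// pi_gt0.
have D0 : 0 < \prod_k L k k by apply: prodr_gt0.
have E : \prod_k scaled k k = (Num.sqrt d%:R)^-1 ^+ p * \prod_k L k k.
  under eq_bigr do rewrite mxE.
  by rewrite big_split prodr_const card_ord.
have lnsqrt (y : R) : 0 < y -> ln (Num.sqrt y) = ln y / 2.
  move=> y0; rewrite -[in RHS](sqr_sqrtr (ltW y0)) lnXn ?sqrtr_gt0//.
  by rewrite mulr2n; field.
rewrite /gauss_volume diag_coords_prod E; move: (2 * pi) pi2 => y y0.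
move: (\prod_k L k k) D0 => D D0.
have sy0 : 0 < Num.sqrt y by rewrite sqrtr_gt0.
have sd0 : 0 < (Num.sqrt d%:R : R)^-1 by rewrite invr_gt0 sqrtr_gt0.
rewrite lnM ?posrE ?expR_gt0 ?mulr_gt0 ?exprn_gt0 ?mulr_gt0 ?exprn_gt0//.
rewrite lnM ?posrE ?exprn_gt0 ?mulr_gt0 ?exprn_gt0// expRK !lnXn ?mulr_gt0 ?exprn_gt0//.
rewrite lnM ?posrE ?exprn_gt0// lnXn// lnV ?posrE ?sqrtr_gt0// !lnsqrt//.
rewrite -[_ *+ (p * _)]mulr_natr -[_ *+ (d * d)]mulr_natr -[_ *+ p]mulr_natr !natrM.
by field; rewrite gt_eqF.
Qed.

Lemma sqnorm_mix_ntrace (L' : 'M[R]_p) t : L' *m L = 1%:M ->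
  let B := @sa_family R p d (mix scaled t) in
  \sum_i tnth t i ^+ 2 = d%:R ^+ 2 *
    \sum_i \sum_j (L'^T *m L') i j * complex.Re (ntrace (B i * B j)).
Proof.
move=> LL B; rewrite (sqnorm_mix _ LL d_gt0) expr2 -mulrA; congr (_ * _).
rewrite mulr_sumr; apply: eq_bigr => i _; rewrite mulr_sumr; apply: eq_bigr => j _.
rewrite /ntrace -(rmorph_nat (real_complex R)) -fmorphV.
case: (\tr _) => a b /=; rewrite mul0r subr0.
by field; rewrite gt_eqF.
Qed.

Lemma lambda_gauss_ub (L' : 'M[R]_p) (G : set ('I_p -> 'M[R[i]]_d)) (x : R) :
  (forall i j : 'I_p, (i < j)%N -> L i j = 0) -> L' *m L = 1%:M ->
  (forall B, G B ->
    \sum_i \sum_j (L'^T *m L') i j * complex.Re (ntrace (B i * B j)) <= 2 * x) ->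
  (lambda G <= (gauss_volume x)%:E)%E.
Proof.
move=> LT LL H; apply: (lebesgue_tuple_gauss_ub (Phi := mix scaled)).
- by apply: diag_coords_gt0.
- by apply: mix_triangular => i j ij; rewrite mxE LT// mulr0.
- exact: expR_ge0.
move=> t /H {}H; rewrite /gauss_weight -expRD -[leLHS]expR0 ler_expR.
suff : \sum_i tnth t i ^+ 2 <= d%:R ^+ 2 * (2 * x) by lra.
by rewrite (sqnorm_mix_ntrace _ LL) ler_pM2l ?exprn_gt0.
Qed.

End EntropyScaling.

Section PositiveMatrices.
Variables (R : realType) (p : nat).
Implicit Types M L : 'M[R]_p.

Lemma det_triangular_sqr L : (forall i j : 'I_p, (i < j)%N -> L i j = 0) ->
  \det (L *m L^T) = (\prod_k L k k) ^+ 2.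
Proof.
move=> LT; rewrite det_mulmx det_tr det_trig -?expr2//.
by apply/is_trig_mxP.
Qed.

Lemma cholesky_gt0 M : positive_mx M -> \det M != 0 -> exists L : 'M[R]_p,
  [/\ forall i j : 'I_p, (i < j)%N -> L i j = 0, forall i, 0 < L i i &
      M = L *m L^T].
Proof.
move=> /cholesky[L [LT L0 ->]]; rewrite (det_triangular_sqr LT) => D.
exists L; split=> // i; rewrite lt_def L0 andbT; apply: contraNneq D => E.
by rewrite (bigD1 i)//= E mul0r expr0n.
Qed.

Lemma positive_mx_shift M (del : R) : positive_mx M -> 0 < del ->
  positive_mx (M + del%:M) /\ \det (M + del%:M) != 0.
Proof.
move=> [MT M0] del0.
have Q (v : 'rV[R]_p) : (v *m (M + del%:M) *m v^T) 0 0 =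
    (v *m M *m v^T) 0 0 + del * \sum_i v 0 i ^+ 2.
  rewrite mulmxDr mulmxDl mxE; congr (_ + _).
  rewrite mul_mx_scalar -scalemxAl mxE mxE; congr (_ * _).
  by apply: eq_bigr => i _; rewrite mxE expr2.
have s0 (v : 'rV[R]_p) : 0 <= \sum_i v 0 i ^+ 2 by apply: sumr_ge0 => i _; exact: sqr_ge0.
split; first split.
- by rewrite linearD /= tr_scalar_mx MT.
- by move=> v; rewrite Q addr_ge0// mulr_ge0// ltW.
apply/negP => /det0P [v v0 vM]; have := Q v; rewrite vM mul0mx mxE => Qv.
have /eqP : \sum_i v 0 i ^+ 2 = 0.
  apply/eqP; rewrite eq_le s0 andbT -(pmulr_rle0 _ del0).
  by have := M0 v; lra.
rewrite psumr_eq0 => [/allP E|i _]; last exact: sqr_ge0.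
move: v0; apply/negP/negPn/eqP/rowP => i.
by have := E i (mem_index_enum _); rewrite /= sqrf_eq0 => /eqP ->; rewrite mxE.
Qed.

(** The determinant of M + x I is the characteristic polynomial of -M at x, hence continuous in
    x. *)
Lemma cvg_det_shift M :
  \det (M + (k.+1%:R^-1)%:M) @[k --> \oo] --> \det M.
Proof.
have E (x : R) : \det (M + x%:M) = (char_poly (- M)).[x].
  rewrite /char_poly -horner_evalE -det_map_mx; congr (\det _).
  by apply/matrixP => i j; rewrite !mxE /= /horner_eval !hornerE hornerMn hornerX opprK addrC.
have -> : \det M = (char_poly (- M)).[0] by rewrite -E raddf0 addr0.
under eq_fun do rewrite E.
by apply: continuous_cvg; [exact: continuous_horner|exact: cvg_harmonic].
Qed.

End PositiveMatrices.

(** * Upper bound for the entropy, from second moments *)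

Section UpperBound.
Variables (R : realType) (A : cstarAlgType R) (phi : {scalar A}).
Variables (n m : nat) (S : 'I_(n + m) -> A).
Hypothesis S_clt : bifree_central_limit phi S.
Notation cov := (cov_mx phi S).
Notation X := (fun i : 'I_n => S (lshift m i)).
Notation Y := (fun j : 'I_m => S (rshift n j)).
Notation p := (n + m)%N.

Lemma norm_Re_lt (z w : R[i]) (eps : R) : `|z - w| < eps%:C ->
  `|complex.Re w - complex.Re z| < eps.
Proof.
case: z w => [a b] [a' b']; rewrite normc_def ltcR => /=; apply: le_lt_trans.
by rewrite -sqrtr_sqr ler_sqrt ?addr_ge0 ?sqr_ge0// -sqrrN opprB lerDl sqr_ge0.
Qed.

Lemma microstates_cov r d eps B i j :
  @microstates R A phi n m X Y r 2 d eps B ->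
  `|complex.Re (ntrace (B i * B j)) - cov i j| < eps.
Proof.
move=> [_ _ H].
have {}H u v c : (1 <= size u + size v <= 2)%N ->
    phi ((\prod_(k <- u) X k) * (\prod_(k <- v) Y k)) = c%:C ->
    `|complex.Re (ntrace ((\prod_(i <- u) B (lshift m i)) *
                (\prod_(j <- rev v) B (rshift n j)))) - c| < eps.
  by move=> uv E; have := norm_Re_lt (H u v uv); rewrite E.
have tC : ntrace (B i * B j) = ntrace (B j * B i) by rewrite /ntrace mxtrace_mulC.
have [i' iE|i' iE] := split_ordP i; have [j' jE|j' jE] := split_ordP j.
- have := H [:: i'; j'] [::] (cov i j) isT.
  by rewrite /= !big_cons !big_nil !mulr1 -iE -jE clt_cov_real//; apply.
- have := H [:: i'] [:: j'] (cov i j) isT.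
  by rewrite /= !big_cons !big_nil !mulr1 -iE -jE clt_cov_real//; apply.
- have := H [:: j'] [:: i'] (cov i j) isT; rewrite tC.
  rewrite /= !big_cons !big_nil !mulr1 -iE -jE clt_cov_real// clt_cov_sym//; exact.
(* Words of right variables are reversed in the matrix trace, hence this order and the symmetry of
   [cov]. *)
- have := H [::] [:: j'; i'] (cov i j) isT.
  rewrite /rev /= !big_cons !big_nil !mulr1 !mul1r -iE -jE clt_cov_real//.
  rewrite clt_cov_sym//; exact.
Qed.

(** With Q the inverse of A + del I, the sum is Tr(Q A) = p - del Tr(Q), and Tr(Q) >= 0. *)
Let tr_inverse_cov (L L' : 'M[R]_p) del : cov + del%:M = L *m L^T ->
  L' *m L = 1%:M -> 0 < del ->
  \sum_i \sum_j (L'^T *m L') i j * cov i j <= p%:R.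
Proof.
move=> E LL del0.
have -> : \sum_i \sum_j (L'^T *m L') i j * cov i j = \tr (L'^T *m L' *m cov).
  apply: eq_bigr => i _; rewrite [RHS]mxE; apply: eq_bigr => j _.
  by rewrite (clt_cov_sym S_clt).
have -> : cov = L *m L^T - del%:M by rewrite -E addrK.
rewrite mulmxBr mul_mx_scalar -mulmxA [L' *m _]mulmxA LL mul1mx -trmx_mul.
rewrite (mulmx1C LL) trmx1 raddfB /= mxtrace1 mxtraceZ lerBlDl lerDr.
rewrite mulr_ge0 ?(ltW del0)//; apply: sumr_ge0 => i _; rewrite mxE.
by apply: sumr_ge0 => j _; rewrite mxE -expr2 sqr_ge0.
Qed.

Lemma clt_chi_R_ub (L : 'M[R]_p) del r : cov + del%:M = L *m L^T -> 0 < del ->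
  (forall i j : 'I_p, (i < j)%N -> L i j = 0) -> (forall k, 0 < L k k) ->
  (chi_R phi X Y r <=
    (p%:R / 2 + p%:R / 2 * ln (2 * pi) + ln (\prod_k L k k))%:E)%E.
Proof.
move=> E del0 LT L0.
have /mulVmx LL : L \in unitmx.
  rewrite unitmxE det_trig; last exact/is_trig_mxP.
  by rewrite unitfE gt_eqF// prodr_gt0.
set L' := invmx L in LL.
pose c := \sum_i \sum_j `|(L'^T *m L') i j|.
have c0 : 0 <= c by apply: sumr_ge0 => i _; apply: sumr_ge0.
apply/lee_addgt0Pr => e e0; pose eps : R := e / (c + 1).
have eps0 : 0 < eps by rewrite divr_gt0// ltr_wpDl.
(* Order M = 2 suffices, whatever the cut-off [r]. *)
apply: le_trans (_ : (chi_RMe phi X Y r 2 eps <= _)%E).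
  by apply: ereal_inf_lbound; exists 2%N, eps.
apply: (@limn_esup_le _ _ _ 1) => d d0.
pose x : R := (p%:R + c * eps) / 2.
have H : (lambda (@microstates R A phi n m X Y r 2 d eps) <= (gauss_volume d L x)%:E)%E.
  apply: (lambda_gauss_ub d0 L0 LT LL) => B HB.
  rewrite /x mulrC divfK//.
  apply: le_trans (_ : \sum_i \sum_j ((L'^T *m L') i j * cov i j +
     `|(L'^T *m L') i j| * eps) <= _).
    apply: ler_sum => i _; apply: ler_sum => j _.
    rewrite -lerBlDl -mulrBr (le_trans (ler_norm _))// normrM ler_wpM2l//.
    by rewrite ltW// (microstates_cov i j HB).
  under eq_bigr do rewrite big_split /= -mulr_suml.
  by rewrite big_split /= -mulr_suml lerD2r (tr_inverse_cov E).
apply: le_trans (_ : ((x + p%:R / 2 * ln (2 * pi) + ln (\prod_k L k k))%:E <= _)%E).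
  rewrite -(entropy_gauss_volume d0 L0) EFinD leeD2r// EFinM lee_pmul2l//; last first.
    by rewrite lte_fin invr_gt0 exprn_gt0// ltr0n.
  rewrite -lne_EFin ?gauss_volume_gt0// lee_lne//= in_itv/= leey andbT.
    exact: lebesgue_tuple_ge0.
  by rewrite lee_fin ltW// gauss_volume_gt0.
rewrite -EFinD lee_fin /x; suff : c * eps <= e by lra.
rewrite /eps mulrCA ler_piMr ?(ltW e0)// ler_pdivrMr ?mul1r ?lerDl//.
by rewrite ltr_wpDl.
Qed.

(* The covariance may be singular, so it is first replaced by cov + I/(k+1). *)
Lemma clt_chi_ub : (chi phi X Y <= ((p%:R / 2 * ln (2 * pi * expR 1))%:E +
   (2^-1)%:E * lne (\det cov)%:E))%E.
Proof.
apply: ge_ereal_sup => _ [r [r0 ->]].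
have pi2 : 0 < 2 * pi :> R by rewrite mulr_gt0// pi_gt0.
rewrite lnM ?posrE ?expR_gt0// expRK mulrDr mulr1.
set c := p%:R / 2 * _ + _.
have H k : (chi_R phi X Y r <= (c + ln (\det (cov + k.+1%:R^-1%:M)) / 2)%:E)%E.
  have k0 : 0 < k.+1%:R^-1 :> R by rewrite invr_gt0 ltr0n.
  have [P D] := positive_mx_shift (clt_cov_positive S_clt) k0.
  have [L [LT L0 E]] := cholesky_gt0 P D.
  have D0 : 0 < \prod_k L k k by apply: prodr_gt0.
  rewrite E det_triangular_sqr// lnXn//.
  apply: (le_trans (clt_chi_R_ub r E k0 LT L0)).
  by rewrite lee_fin /c; lra.
have Dk k : 0 < \det (cov + k.+1%:R^-1%:M).
  have k0 : 0 < k.+1%:R^-1 :> R by rewrite invr_gt0 ltr0n.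
  have [P D] := positive_mx_shift (clt_cov_positive S_clt) k0.
  have [L [LT L0 E]] := cholesky_gt0 P D.
  by rewrite E det_triangular_sqr// exprn_gt0// prodr_gt0.
case: (chi_R phi X Y r) H => [x|/(_ 0)|_]; last 2 first.
- by rewrite leye_eq.
- exact: leNye.
move=> H.
(* In the limit a finite value [x] forces a positive determinant, so a singular covariance leaves
   only minus infinity. *)
have ED : expR (2 * (x - c)) <= \det cov.
  have cu := @cvg_det_shift R p cov.
  rewrite -(cvg_lim _ cu)//.
  apply: limr_ge; first exact: cvgP cu.
  apply: nearW => k; rewrite -[leRHS]lnK ?posrE// ler_expR.
  by have := H k; rewrite lee_fin; lra.
have D0 : 0 < \det cov by apply: lt_le_trans ED; exact: expR_gt0.
rewrite lne_EFin// -EFinM -EFinD lee_fin.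
by move: ED; rewrite -[X in _ <= X -> _]lnK ?posrE// ler_expR; lra.
Qed.

End UpperBound.

(** * The deviation polynomial *)

Section Deviation.
Variables (R : realType) (p d : nat) (L : 'M[R]_p) (s : seq 'I_p -> R).
Hypothesis d_gt0 : (0 < d)%N.
Notation C := R[i].
Notation N := (p * (d * d))%N.
Notation P := (mpoly N C).
Notation G := (gauss_mx L d).
Notation B t := (sa_family (mix ((Num.sqrt d%:R)^-1 *: L) t)).

Let dR0 : d%:R != 0 :> R. Proof. by rewrite pnatr_eq0 -lt0n. Qed.

Lemma meval_trwords t ws : meval (rval t) (trwords G ws) =
  \prod_(w <- ws) \tr (\prod_(k <- w) B t k).
Proof.
by rewrite /trwords rmorph_prod; apply: eq_bigr => w _; exact: meval_gauss_trword.
Qed.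

Let Re_mexpectD (q q' : P) :
  complex.Re (mexpect (q + q')) = complex.Re (mexpect q) + complex.Re (mexpect q').
Proof.
rewrite (raddfD (@mexpect R N)); exact: raddfD.
Qed.

Let Re_mexpectB (q q' : P) :
  complex.Re (mexpect (q - q')) = complex.Re (mexpect q) - complex.Re (mexpect q').
Proof.
rewrite (raddfB (@mexpect R N)); exact: raddfB.
Qed.

Let Re_mexpectZ (c : R) (q : P) :
  complex.Re (mexpect (c%:C *: q)) = c * complex.Re (mexpect q).
Proof.
have -> : mexpect (c%:C *: q) = c%:C * mexpect q by exact: linearZ.
by case: (mexpect q) => a b /=; rewrite mul0r subr0.
Qed.

Let Re_mexpect_sum (J : Type) (u : seq J) (q : J -> P) :
  complex.Re (mexpect (\sum_(x <- u) q x)) = \sum_(x <- u) complex.Re (mexpect (q x)).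
Proof.
elim: u => [|x u IH]; first by rewrite !big_nil (raddf0 (@mexpect R N)).
by rewrite !big_cons Re_mexpectD IH.
Qed.

Lemma Re_mexpect_trwords (c : R) ws :
  complex.Re (mexpect (c%:C *: trwords G ws)) = c * d%:R ^+ size ws * mean_traces L d ws.
Proof.
rewrite Re_mexpectZ -mulrA; congr (_ * _).
by rewrite mulrC divfK// expf_neq0.
Qed.

(** The expansion of |tau(w) - s(w)|^2. It is a polynomial because the conjugate trace of a word in
    self-adjoint matrices is the trace of the reversed word. *)
Definition word_error w : P :=
  (d%:R ^- 2)%:C *: trwords G [:: w; rev w] - (s w / d%:R)%:C *: trwords G [:: w]
  - (s w / d%:R)%:C *: trwords G [:: rev w] + (s w ^+ 2)%:C *: trwords G [::].

Lemma meval_word_error t w : meval (rval t) (word_error w) =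
  `|(s w)%:C - ntrace (\prod_(k <- w) B t k)| ^+ 2.
Proof.
rewrite /word_error mevalD 2!mevalB !mevalZ !meval_trwords !big_cons !big_nil !mulr1.
have -> : `|(s w)%:C - ntrace (\prod_(k <- w) B t k)| ^+ 2 =
    ((s w)%:C - d%:R^-1 * \tr (\prod_(k <- w) B t k)) *
    ((s w)%:C - d%:R^-1 * \tr (\prod_(k <- rev w) B t k)).
  rewrite sqr_normc; congr (_ * _); rewrite rmorphB.
  congr (_ - _); first exact: conjc_real.
  rewrite /ntrace [LHS]rmorphM fmorphV rmorph_nat; congr (_ * _).
  by apply: trace_word_rev => k; exact: sa_mx_hermitian.
have -> : (d%:R ^- 2)%:C = d%:R^-1 * d%:R^-1 :> C.
  by rewrite fmorphV (rmorphXn (real_complex R)) rmorph_nat expr2 invfM.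
have -> : (s w / d%:R)%:C = (s w)%:C * d%:R^-1.
  by rewrite (rmorphM (real_complex R)) fmorphV rmorph_nat.
have -> : (s w ^+ 2)%:C = (s w)%:C * (s w)%:C by rewrite -(rmorphM (real_complex R)).
move: (\tr _) (\tr _) (d%:R^-1) ((s w)%:C) => a b c e; ring.
Qed.

Lemma Re_mexpect_word_error w : complex.Re (mexpect (word_error w)) =
  mean_traces L d [:: w; rev w] - s w * mean_traces L d [:: w]
  - s w * mean_traces L d [:: rev w] + s w ^+ 2.
Proof.
have E (a b c e : P) : complex.Re (mexpect (a - b - c + e)) = complex.Re (mexpect a) -
    complex.Re (mexpect b) - complex.Re (mexpect c) + complex.Re (mexpect e).
  by rewrite Re_mexpectD !Re_mexpectB.
rewrite [LHS]E; congr (_ - _ - _ + _); rewrite Re_mexpect_trwords /=.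
- by rewrite mulVf ?mul1r// expf_neq0.
- by rewrite expr1 divfK.
- by rewrite expr1 divfK.
- by rewrite expr0 mulr1 mean_traces0 mulr1.
Qed.

(* A polynomial Markov inequality: where the deviation is below 1 the matrices are
   microstates, while its mean tends to 0. *)
Definition deviation (W : seq (seq 'I_p)) (eps r : R) (K : nat) : P :=
  \sum_(w <- W) (eps ^- 2)%:C *: word_error w +
  \sum_k (r ^- K)%:C *: trwords G [:: nseq K k].

Lemma meval_deviation t W eps r K : meval (rval t) (deviation W eps r K) =
  \sum_(w <- W) (eps ^- 2)%:C * `|(s w)%:C - ntrace (\prod_(k <- w) B t k)| ^+ 2 +
  \sum_k (r ^- K)%:C * \tr (B t k ^+ K).
Proof.
rewrite /deviation mevalD !raddf_sum; congr (_ + _); apply: eq_bigr => k _ /=.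
  by rewrite mevalZ meval_word_error.
by rewrite mevalZ meval_trwords big_seq1 big_nseq -Monoid.iteropE.
Qed.

Lemma Re_mexpect_deviation W eps r K : complex.Re (mexpect (deviation W eps r K)) =
  \sum_(w <- W) eps ^- 2 * (mean_traces L d [:: w; rev w] - s w * mean_traces L d [:: w]
     - s w * mean_traces L d [:: rev w] + s w ^+ 2) +
  \sum_k d%:R / r ^+ K * mean_traces L d [:: nseq K k].
Proof.
rewrite /deviation Re_mexpectD !Re_mexpect_sum; congr (_ + _); apply: eq_bigr => k _.
  by rewrite Re_mexpectZ Re_mexpect_word_error.
by rewrite Re_mexpect_trwords expr1 mulrAC mulrC mulrA.
Qed.

Lemma trace_hermitian_even (M : 'M[C]_d) K : M \is hermsymmx -> 0 <= \tr (M ^+ K.*2).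
Proof.
move=> /sesquiP; rewrite expr0 scale1r => Mh.
have H k : M ^+ k = (map_mx conjc (M ^+ k))^T.
  elim: k => [|k IH]; first by rewrite expr0 map_mx1 trmx1.
  rewrite {2}exprSr -[M ^+ k * M]/(M ^+ k *m M) map_mxM trmx_mul -IH exprS.
  by congr (_ * _); rewrite {1}Mh map_trmx.
rewrite -addnn exprD {2}H; apply: sumr_ge0 => i _; rewrite mxE.
by apply: sumr_ge0 => j _; rewrite !mxE -sqr_normc exprn_ge0.
Qed.

Lemma meval_deviation_ge0 t W (eps r : R) K : 0 < r ->
  0 <= meval (rval t) (deviation W eps r K.*2).
Proof.
move=> r0; rewrite meval_deviation addr_ge0//; apply: sumr_ge0 => k _.
  by rewrite mulr_ge0 ?exprn_ge0// lecR invr_ge0 sqr_ge0.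
rewrite mulr_ge0//; first by rewrite lecR invr_ge0 exprn_ge0// ltW.
by apply: trace_hermitian_even; exact: sa_mx_hermitian.
Qed.

(** All summands are nonnegative, so each of them is below 1; the trace terms then have the form
    required by [opnorm_le_trace]. *)
Lemma small_deviation t W (eps r : R) J : 0 < eps -> 0 < r ->
  meval (rval t) (deviation W eps r (2 ^ J.+1)) < 1 ->
  (forall w, w \in W -> `|(s w)%:C - ntrace (\prod_(k <- w) B t k)| < eps%:C) /\
  (forall k, opnorm (B t k) <= r).
Proof.
move=> eps0 r0; rewrite meval_deviation => H.
have K2 : (2 ^ J.+1 = (2 ^ J).*2)%N by rewrite expnS mul2n.
have T0 k : 0 <= (r ^- (2 ^ J.+1))%:C * \tr (B t k ^+ (2 ^ J.+1)).
  rewrite mulr_ge0//; first by rewrite lecR invr_ge0 exprn_ge0// ltW.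
  by rewrite K2 trace_hermitian_even//; exact: sa_mx_hermitian.
have W0 w : 0 <= (eps ^- 2)%:C * `|(s w)%:C - ntrace (\prod_(k <- w) B t k)| ^+ 2.
  by rewrite mulr_ge0 ?exprn_ge0// lecR invr_ge0 sqr_ge0.
split=> [w wW|k].
  have : (eps ^- 2)%:C * `|(s w)%:C - ntrace (\prod_(k <- w) B t k)| ^+ 2 < 1.
    apply: le_lt_trans H; rewrite (perm_big _ (perm_to_rem wW)) big_cons -addrA lerDl.
    by rewrite addr_ge0// sumr_ge0.
  rewrite fmorphV rmorphXn /= mulrC ltr_pdivrMr ?mul1r; last first.
    by rewrite exprn_gt0// ltcR.
  by rewrite ltr_pXn2r// nnegrE lecR ltW.
apply: (opnorm_le_trace (J := J)) => //; first exact: sa_mx_hermitian.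
have : (r ^- (2 ^ J.+1))%:C * \tr (B t k ^+ (2 ^ J.+1)) < 1.
  apply: le_lt_trans H; rewrite (bigD1 k)//= addrCA lerDl.
  by rewrite addr_ge0// sumr_ge0.
rewrite fmorphV mulrC ltr_pdivrMr ?ltcR ?exprn_gt0// mul1r; exact: ltW.
Qed.

End Deviation.

Definition all_words (p M : nat) : seq (seq 'I_p) :=
  flatten [seq [seq val t | t : k.-tuple 'I_p] | k <- iota 0 M.+1].

Lemma mem_all_words p M (w : seq 'I_p) : (size w <= M)%N -> w \in all_words p M.
Proof.
move=> wM; apply/flattenP; exists [seq val t | t : (size w).-tuple 'I_p].
  by apply/mapP; exists (size w) => //; rewrite mem_iota.
by apply/mapP; exists (in_tuple w); rewrite ?mem_enum.
Qed.

(** For n = 2^(J+1) the right-hand side is d^2 with d = 2^(2^J): the condition of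
    [mean_trace_power_le]. *)
Lemma cube_le_exp2 n : (16 <= n)%N -> (n.+1 ^ 3 <= 2 ^ n)%N.
Proof.
elim: n => // n IH; rewrite leq_eqVlt => /predU1P[<-//|n16].
have {}IH := IH n16; rewrite [leqRHS]expnS; apply: leq_trans (leq_mul (leqnn 2) IH).
by rewrite !expnS !expn0; move: n16; clear; nia.
Qed.

(** * Lower bound for an invertible covariance *)

Section LowerBound.
Variables (R : realType) (A : cstarAlgType R) (phi : {scalar A}).
Variables (n m : nat) (S : 'I_(n + m) -> A).
Hypothesis S_clt : bifree_central_limit phi S.
Hypothesis S_var : forall k, phi (S k * S k) = 1.
Notation cov := (cov_mx phi S).
Notation X := (fun i : 'I_n => S (lshift m i)).
Notation Y := (fun j : 'I_m => S (rshift n j)).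
Notation p := (n + m)%N.
Notation s := (free_moment cov).

Variable L : 'M[R]_p.
Hypothesis cov_L : cov = L *m L^T.
Hypothesis L_tri : forall i j : 'I_p, (i < j)%N -> L i j = 0.
Hypothesis L_gt0 : forall k, 0 < L k k.

Let L' := invmx L.
Let LL : L' *m L = 1%:M.
Proof.
apply: mulVmx; rewrite unitmxE det_trig; last exact/is_trig_mxP.
by rewrite unitfE gt_eqF// prodr_gt0.
Qed.

Let c : R := \sum_i \sum_j `|(L'^T *m L') i j|.
Let c_ge0 : 0 <= c.
Proof. by apply: sumr_ge0 => i _; apply: sumr_ge0. Qed.

Lemma le_microstates r M M' d (eps eps' : R) : (M' <= M)%N -> eps <= eps' ->
  @microstates R A phi n m X Y r M d eps `<=`
  @microstates R A phi n m X Y r M' d eps'.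
Proof.
move=> MM ee B [Bh Br BM]; split=> // u v /andP[uv0 uvM].
apply: lt_le_trans (BM u v _) _; last by rewrite lecR.
by rewrite uv0 (leq_trans uvM).
Qed.

Section FixedDimension.
Variables (d M J : nat) (eps r : R).
Hypothesis d_gt0 : (0 < d)%N.
Hypothesis M_ge2 : (2 <= M)%N.
Hypothesis eps_gt0 : 0 < eps.
Hypothesis r_gt0 : 0 < r.
Notation scaled := ((Num.sqrt d%:R)^-1 *: L).
Notation dev := (deviation d L s (all_words p M) eps r (2 ^ J.+1)).
Notation x := ((p%:R - c * eps) / 2).

Lemma deviation_microstates t : meval (rval t) dev < 1 ->
  @microstates R A phi n m X Y r M d eps (sa_family (mix scaled t)).
Proof.
move=> /(small_deviation eps_gt0 r_gt0) [Hw Hr].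
split=> // [k|u v /andP[_ uvM]]; first exact: sa_mx_hermitian.
pose w := map (@lshift n m) u ++ map (@rshift n m) (rev v).
have /Hw : w \in all_words p M.
  by apply: mem_all_words; rewrite size_cat !size_map size_rev.
by rewrite (clt_mixed_moment S_clt) /w big_cat !big_map -map_rev.
Qed.

Lemma microstates_weight t :
  @microstates R A phi n m X Y r M d eps (sa_family (mix scaled t)) ->
  expR (d%:R ^+ 2 * x) * gauss_weight t <= 1.
Proof.
move=> /(le_microstates M_ge2 (lexx _)) H.
rewrite /gauss_weight -expRD -[leRHS]expR0 ler_expR.
rewrite (sqnorm_mix_ntrace d_gt0 _ LL).
set Q := \sum_i _; suff : p%:R - c * eps <= Q.
  by rewrite -(ler_pM2l (_ : 0 < d%:R ^+ 2)) ?exprn_gt0 ?ltr0n//; lra.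
have <- : \sum_i \sum_j (L'^T *m L') i j * cov i j = p%:R.
  transitivity (\tr (L'^T *m L' *m cov)).
    apply: eq_bigr => i _; rewrite [RHS]mxE; apply: eq_bigr => j _.
    by rewrite (clt_cov_sym S_clt).
  rewrite cov_L -mulmxA [L' *m _]mulmxA LL mul1mx -trmx_mul.
  by rewrite (mulmx1C LL) trmx1 mxtrace1.
rewrite /c mulr_suml -sumrB; apply: ler_sum => i _.
rewrite mulr_suml -sumrB; apply: ler_sum => j _.
rewrite lerBlDl -lerBlDr -mulrBr (le_trans (ler_norm _))// normrM ler_wpM2l//.
by rewrite distrC ltW// (microstates_cov S_clt i j H).
Qed.

(** The minorant is exp(d^2 x) (1 - dev) times the weight: nonpositive where dev >= 1, and at most 1
    on microstates because dev >= 0. Its mean loses a factor 1/2 at most, which exp(-d^2 eta) <=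
    exp(-1) absorbs. *)
Lemma lambda_gauss_lb eta : 1 <= d%:R ^+ 2 * eta -> complex.Re (mexpect dev) <= 2^-1 ->
  ((gauss_volume d L (x - eta))%:E <= lambda (@microstates R A phi n m X Y r M d eps))%E.
Proof.
move=> eta1 dev2; set c0 := expR (d%:R ^+ 2 * x).
pose f : mpoly (p * (d * d)) R[i] := c0%:C *: (1 - dev).
have fE t : complex.Re (meval (rval t) f) = c0 * (1 - complex.Re (meval (rval t) dev)).
  rewrite /f mevalZ mevalB meval1; case: (meval _ _) => a b /=.
  by rewrite mul0r subr0.
have fEE : complex.Re (mexpect f) = c0 * (1 - complex.Re (mexpect dev)).
  have -> : mexpect f = c0%:C * (1 - mexpect dev).
    rewrite -(@mexpect1 R (p * (d * d))) /f.
    transitivity (c0%:C * mexpect (1 - dev)); first exact: linearZ.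
    by congr (_ * _); exact: raddfB.
  by case: (mexpect dev) => a b /=; rewrite mul0r subr0.
apply: le_trans (lebesgue_tuple_gauss_lb (Phi := mix scaled)
   (al := diag_coords (d := d) scaled)
   (s := [seq (complex.Re (mcoeff m0 f), multinom_val m0) | m0 <- msupp f]) _ _ _).
- rewrite lee_fin pexpect_mexpect fEE ler_wpM2r//.
    rewrite mulr_ge0 ?exprn_ge0 ?sqrtr_ge0//; apply: prodr_ge0 => i _.
    by apply/ltW/diag_coords_gt0 => k; rewrite mxE mulr_gt0// invr_gt0 sqrtr_gt0 ltr0n.
  rewrite mulrBr expRD ler_pM2l ?expR_gt0//.
  apply: le_trans (_ : 2^-1 <= _); last by lra.
  rewrite expRN lef_pV2 ?posrE ?expR_gt0//; apply: le_trans (_ : expR 1 <= _).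
    by have := expR_ge1Dx (1 : R); lra.
  by rewrite ler_expR.
- by apply: diag_coords_gt0 => k; rewrite mxE mulr_gt0// invr_gt0 sqrtr_gt0 ltr0n.
- by apply: mix_triangular => i j ij; rewrite mxE L_tri// mulr0.
move=> t; rewrite peval_meval fE.
have q0 : 0 <= meval (rval t) dev.
  by rewrite expnS mul2n; exact: meval_deviation_ge0.
have [q1|q1] := ltP (complex.Re (meval (rval t) dev)) 1; last first.
  apply: le_trans (_ : 0 <= _); last by rewrite /indic ler0n.
  by rewrite mulr_le0_ge0 ?expR_ge0// pmulr_rle0 ?expR_gt0// subr_le0.
have q1C : meval (rval t) dev < 1.
  by move: q0; rewrite lecE ltcE q1 /= andbT => /andP[/eqP -> _].
have /deviation_microstates Ht := q1C.
rewrite indicE mem_set//; apply: le_trans (microstates_weight Ht).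
rewrite ler_wpM2r ?expR_ge0// ler_piMr ?expR_ge0// gerBl.
by move: q0; rewrite lecE => /andP[].
Qed.

End FixedDimension.

Let mean_word_error w d : R :=
  mean_traces L d [:: w; rev w] - s w * mean_traces L d [:: w]
  - s w * mean_traces L d [:: rev w] + s w ^+ 2.

Let cvg_mean_word_error w : mean_word_error w d @[d --> \oo] --> 0.
Proof.
have H ws : mean_traces L d ws @[d --> \oo] --> \prod_(w <- ws) s w.
  rewrite cov_L; apply: cvg_mean_traces => [d _|d ? d0|d k u ? d0].
  - exact: mean_traces0.
  - exact: mean_traces_nil.
  - exact: mean_traces_cons.
have -> : 0 = s w * s (rev w) - s w * s w - s w * s (rev w) + s w ^+ 2.
  by rewrite expr2; ring.
have := H [:: w; rev w]; rewrite !big_cons big_nil mulr1 => H2.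
have := H [:: w]; rewrite big_seq1 => H1.
have := H [:: rev w]; rewrite big_seq1 => H1'.
apply: cvgD; last exact: cvg_cst.
by apply: cvgB; [apply: cvgB => //|]; apply: cvgMr.
Qed.

Let mean_deviation M (eps : R) d : R :=
  \sum_(w <- all_words p M) eps ^- 2 * mean_word_error w d.

Let cvg_mean_deviation M eps : mean_deviation M eps d @[d --> \oo] --> 0.
Proof.
rewrite (_ : 0 = \sum_(w <- all_words p M) eps ^- 2 * 0); last first.
  by rewrite big1// => w _; rewrite mulr0.
apply: cvg_sum_seq => w _; apply: cvgMr; exact: cvg_mean_word_error.
Qed.

(* With K = 2^J and d = 2^K, the power 2K = 2^(J+1) can be reached by repeated
   squaring, satisfies (2K+1)^3 <= d^2, and d (8/16)^(2K) = 1/d.  The lim sup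
   defining the entropy only needs this subsequence of dimensions. *)
Lemma exists_dimension M (eps : R) n0 : exists J : nat,
  (n0 <= 2 ^ 2 ^ J)%N /\ complex.Re (mexpect
    (deviation (2 ^ 2 ^ J) L s (all_words p M) eps 16 (2 ^ J.+1))) <= 2^-1.
Proof.
have [n1 _ Hn1] : \forall d \near \oo, mean_deviation M eps d < 4^-1.
  by apply: (cvgr_lt _ (cvg_mean_deviation M eps)); rewrite invr_gt0.
(* [n0] and [n1] make d large enough, [4 * p] gives p / d <= 1/4 for the trace terms, and the last 4
   ensures 16 <= 2^(J+1). *)
pose J := (n0 + n1 + 4 * p + 4)%N; exists J; set d := (2 ^ 2 ^ J)%N.
have Jd : (J <= d)%N by rewrite ltnW// (ltn_trans (ltn_expl J _) (ltn_expl _ _)).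
split; first by apply: leq_trans Jd; rewrite /J; lia.
have d0 : (0 < d)%N by rewrite expn_gt0.
have dd : (d ^ 2 = 2 ^ 2 ^ J.+1)%N by rewrite -expnM -expnSr.
rewrite Re_mexpect_deviation//.
have E1 : mean_deviation M eps d < 4^-1.
  by apply: Hn1; apply: leq_trans Jd; rewrite /J; lia.
rewrite -/(mean_deviation M eps d).
suff E2 : \sum_k d%:R / 16 ^+ (2 ^ J.+1) * mean_traces L d [:: nseq (2 ^ J.+1) k] <= 4^-1 :> R.
  by lra.
have J16 : (16 <= 2 ^ J.+1)%N by rewrite (@leq_exp2l 2 4)// /J; lia.
apply: le_trans (_ : \sum_(k < p) d%:R^-1 <= _).
  apply: ler_sum => k _.
  have mk : mean_traces L d [:: nseq (2 ^ J.+1) k] <= 8 ^+ (2 ^ J.+1).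
    apply: (@mean_trace_power_le _ _ (fun k l => (L *m L^T) k l)) => //.
    - by move=> d' _; exact: mean_traces0.
    - by move=> d' ws; exact: mean_traces_nil.
    - by move=> d' k' w ws; exact: mean_traces_cons.
    - by rewrite -cov_L mxE S_var.
    - by rewrite dd cube_le_exp2.
  apply: le_trans (ler_wpM2l _ mk) _; first by rewrite divr_ge0 ?exprn_ge0.
  have -> : 16 ^+ (2 ^ J.+1) = 8 ^+ (2 ^ J.+1) * d%:R ^+ 2 :> R.
    by rewrite -[d%:R ^+ 2]natrX dd [(2 ^ _)%:R]natrX -exprMn; congr (_ ^+ _); lra.
  have e8 : 8 ^+ (2 ^ J.+1) != 0 :> R by rewrite expf_neq0.
  have dn0 : d%:R != 0 :> R by rewrite pnatr_eq0 -lt0n.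
  move: (8 ^+ _) e8 => y y0; rewrite le_eqVlt; apply/orP; left; apply/eqP.
  by field; rewrite dn0.
rewrite sumr_const card_ord -[_ *+ p]mulr_natl ler_pdivrMr ?ltr0n//.
have : (4 * p)%:R <= d%:R :> R by rewrite ler_nat; apply: leq_trans Jd; rewrite /J; lia.
by rewrite natrM; lra.
Qed.

Lemma clt_chi_lb : ((p%:R / 2 + p%:R / 2 * ln (2 * pi) + ln (\prod_k L k k))%:E
  <= chi phi X Y)%E.
Proof.
(* One cut-off suffices for the supremum; 16 is twice the rate 8 of the mean traces. *)
apply: le_trans (_ : (chi_R phi X Y 16 <= _)%E); last first.
  by apply: ereal_sup_ubound; exists 16.
apply: le_ereal_inf_tmp => _ [M [eps [eps0 ->]]].
apply/lee_addgt0Pr => e e0.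
have ce0 : 0 < e / (c + 1) by rewrite divr_gt0// ltr_wpDl.
(* [eta] is both the accuracy of the smaller microstates and the loss in the exponent: in total c
   eta / 2 + eta <= e. *)
pose eta : R := Num.min eps (e / (c + 1)).
have eta0 : 0 < eta by rewrite lt_min eps0.
have etae : c * eta + eta <= e.
  by rewrite -{2}[eta]mul1r -mulrDl mulrC -ler_pdivlMr ?ltr_wpDl// ge_min lexx orbT.
set V := _ + ln (\prod_k L k k).
suff : ((V - e)%:E <= chi_RMe phi X Y 16 M eps)%E.
  by move=> /(leeD2r e%:E); rewrite -EFinD subrK.
apply: le_limn_esup => n0.
(* Order at least 2 gives access to the second moments; [Num.bound eta^-1] ensures 1 <= d^2 eta. *)
have [J [Jn0 dev2]] := exists_dimension (maxn M 2) eta (n0 + Num.bound eta^-1).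
set d := (2 ^ 2 ^ J)%N in Jn0 dev2; exists d; first by lia.
have d0 : (0 < d)%N by rewrite expn_gt0.
have eta1 : 1 <= d%:R ^+ 2 * eta.
  rewrite -ler_pdivrMr// mul1r; apply: le_trans (_ : d%:R <= _).
    apply: le_trans (ltW (archi_boundP _)) _; first by rewrite invr_ge0 ltW.
    by rewrite ler_nat (leq_trans _ Jn0)// leq_addl.
  by rewrite expr2 ler_peMl// ler1n.
have r0 : 0 < 16 :> R by [].
have := lambda_gauss_lb d0 (leq_maxr M 2) eta0 r0 eta1 dev2.
move=> HG; pose x : R := (p%:R - c * eta) / 2.
have {}HG : ((gauss_volume d L (x - eta))%:E <=
    lambda (@microstates R A phi n m X Y 16 M d eps))%E.
  apply: le_trans HG _; apply: le_lebesgue_tuple => t; apply: le_microstates.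
    exact: leq_maxl.
  by rewrite ge_min lexx.
apply: le_trans (_ : ((x - eta + p%:R / 2 * ln (2 * pi) + ln (\prod_k L k k))%:E <= _)%E).
  have cE : 0 <= c * eta by rewrite mulr_ge0// ltW.
  by rewrite lee_fin /V /x; lra.
rewrite -(entropy_gauss_volume d0 L_gt0) EFinD leeD2r// EFinM lee_pmul2l//; last first.
  by rewrite lte_fin invr_gt0 exprn_gt0// ltr0n.
rewrite -lne_EFin ?gauss_volume_gt0// lee_lne//= in_itv/= leey andbT.
  by rewrite lee_fin ltW// gauss_volume_gt0.
exact: lebesgue_tuple_ge0.
Qed.

End LowerBound.

Theorem theorem7p4 (R : realType) (A : cstarAlgType R) (phi : {scalar A})
    (n m : nat) (S : 'I_(n + m) -> A)
    (phi_state : is_state phi)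
    (S_clt : bifree_central_limit phi S)
    (S_var : forall k, phi (S k * S k) = 1) :
  [/\ (* the covariance matrix is real and positive *)
      forall i j, phi (S i * S j) = (cov_mx phi S i j)%:C,
      positive_mx (cov_mx phi S),
      (* it determines the joint distribution *)
      forall (B : cstarAlgType R) (psi : {scalar B}) (T : 'I_(n + m) -> B),
        is_state psi -> bifree_central_limit psi T ->
        cov_mx psi T = cov_mx phi S ->
        forall w : seq 'I_(n + m),
          psi (\prod_(k <- w) T k) = phi (\prod_(k <- w) S k) &
      chi phi (fun i : 'I_n => S (lshift m i)) (fun j : 'I_m => S (rshift n j)) =
      (((n + m)%:R / 2 * ln (2 * pi * expR 1))%:E +
       (2^-1)%:E * lne (\det (cov_mx phi S))%:E)%E].
Proof.
split.
- exact: clt_cov_real.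
- exact: clt_cov_positive.
- by move=> B psi T _ T_clt E; exact: clt_moments_determined.
apply/eqP; rewrite eq_le clt_chi_ub// andTb.
have [D|D] := eqVneq (\det (cov_mx phi S)) 0.
  (* The right-hand side is minus infinity, so only the upper bound has content. *)
  by rewrite D le0_lneNy// mulrNy gtr0_sg// mul1e addeNy leNye.
have [L [LT L0 E]] := cholesky_gt0 (clt_cov_positive S_clt) D.
have P0 : 0 < \prod_k L k k by apply: prodr_gt0.
apply: le_trans (clt_chi_lb S_clt S_var E LT L0).
have pi2 : 0 < 2 * pi :> R by rewrite mulr_gt0// pi_gt0.
rewrite E det_triangular_sqr// lne_EFin ?exprn_gt0// lnXn// -EFinM -EFinD lee_fin.
by rewrite lnM ?posrE ?expR_gt0// expRK; lra.
Qed.
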